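(* Let $n \ge m \ge 1$ be integers and let $\bm{A} \in \mathbb{R}^{nm \times nm}$ be symmetric positive semidefinite. Let $\bm{W}^\star$ be an optimal solution to the semidefinite relaxation $$\max_{\bm{W} \in \mathcal{S}^{nm}_+} \ \langle \bm{A}, \bm{W} \rangle \quad \text{s.t.} \quad \sum_{i=1}^m \bm{W}^{(i,i)} \preceq \bm{I}_n, \qquad \operatorname{tr}\big( \bm{W}^{(j,j')} \big)= \delta_{j,j'} \ \ \forall j, j' \in \{1,\dots,m\}.$$ Let $\bm{Q} \in \mathbb{R}^{n \times m}$ be the random semi-orthogonal matrix generated by the relax-and-project algorithm from $\bm{W}^\star$ (defined in the context). Then $$\mathbb{E}\left[\operatorname{vec}(\bm{Q})^\top \bm{A} \operatorname{vec}(\bm{Q}) \right] \ \geq \ \frac{1}{3} \langle \bm{A}, \bm{W}^\star \rangle.$$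
   Context: $\mathcal{S}^{d}_+$ is the cone of $d\times d$ real symmetric positive semidefinite matrices, $\preceq$ is the Loewner order, $\langle\cdot,\cdot\rangle$ is the Frobenius inner product, $\delta_{j,j'}$ is the Kronecker delta. $\operatorname{vec}(\bm{X})\in\mathbb{R}^{nm}$ stacks the columns of $\bm{X}\in\mathbb{R}^{n\times m}$. An $nm\times nm$ matrix $\bm{W}$ is viewed as an $m\times m$ array of $n\times n$ blocks, and $\bm{W}^{(i,j)}$ denotes its $(i,j)$ block. The underlying problem is $\max\{\operatorname{vec}(\bm{U})^\top \bm{A} \operatorname{vec}(\bm{U}) : \bm{U}\in\mathbb{R}^{n\times m},\ \bm{U}^\top\bm{U}=\bm{I}_m\}$, of which the semidefinite program in the claim is a relaxation. Relax-and-project algorithm: given an optimal solution $\bm{W}^\star$ of the relaxation, sample a random matrix $\bm{G}\in\mathbb{R}^{n\times m}$ with $\operatorname{vec}(\bm{G}) \sim \mathcal{N}(\bm{0}_{nm}, \bm{W}^\star)$ (centered Gaussian with covariance $\bm{W}^\star$, possibly degenerate); compute a singular value decomposition $\bm{G}=\bm{U}\bm{\Sigma}\bm{V}^\top$ with $\bm{U}\in\mathbb{R}^{n\times m}$, $\bm{U}^\top\bm{U}=\bm{I}_m$, $\bm{\Sigma}\in\mathbb{R}^{m\times m}$ diagonal with nonnegative entries, and $\bm{V}\in\mathbb{R}^{m\times m}$ orthogonal (chosen measurably in $\bm{G}$); return $\bm{Q}=\bm{U}\bm{V}^\top$, which satisfies $\bm{Q}^\top\bm{Q}=\bm{I}_m$.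 *)

(* Defs.v *)
From HB Require Import structures.
From mathcomp Require Import all_boot all_order all_algebra.
From mathcomp Require Import all_classical all_reals all_analysis.
Import Order.TTheory GRing.Theory Num.Theory.
Import numFieldNormedType.Exports.

Set Implicit Arguments.
Unset Strict Implicit.
Unset Printing Implicit Defensive.

Local Open Scope classical_set_scope.
Local Open Scope ring_scope.

(* Matrices carry the product sigma-algebra, generated by the coordinate maps;
   for real entries it is the Borel sigma-algebra. *)
Definition mx_display : measure_display -> measure_display.
Proof. exact. Qed.

Section measurable_matrix.
Context {d : measure_display} {T : measurableType d}.
Variables m n : nat.

Definition mx_cylinders : set (set 'M[T]_(m, n)) :=
  [set C | exists i j (B : set T),
     measurable B /\ C = (fun M : 'M[T]_(m, n) => M i j) @^-1` B].

Let mx_set0 : <<s mx_cylinders >> set0.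
Proof. exact: sigma_algebra0. Qed.

Let mx_setC A : <<s mx_cylinders >> A -> <<s mx_cylinders >> (~` A).
Proof. exact: sigma_algebraC. Qed.

Let mx_bigcup (F : (set 'M[T]_(m, n))^nat) :
  (forall i, <<s mx_cylinders >> (F i)) -> <<s mx_cylinders >> (\bigcup_i F i).
Proof. exact: sigma_algebra_bigcup. Qed.

HB.instance Definition _ := @isMeasurable.Build (mx_display d)
  'M[T]_(m, n) <<s mx_cylinders >> mx_set0 mx_setC mx_bigcup.

End measurable_matrix.

Section semidefinite_program.
Context {R : realType}.

Definition psdmx k (X : 'M[R]_k) : Prop :=
  X^T = X /\ forall x : 'cV[R]_k, 0 <= (x^T *m X *m x) 0 0.

Definition loewner_le k (X Y : 'M[R]_k) : Prop := psdmx (Y - X).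

Definition frobenius p q (X Y : 'M[R]_(p, q)) : R := \tr (X^T *m Y).

(* mxvec concatenates rows, hence the transpose: vec stacks the m columns of X,
   and X k j sits at index mxvec_index j k, with value j * n + k. *)
Definition vec n m (X : 'M[R]_(n, m)) : 'cV[R]_(m * n) := (mxvec X^T)^T.

(* (i, j) block in the m x m array of n x n blocks, indexed as in vec. *)
Definition mxblk n m (W : 'M[R]_(m * n)) (i j : 'I_m) : 'M[R]_n :=
  \matrix_(k, l) W (mxvec_index i k) (mxvec_index j l).

Definition sdp_feasible n m (W : 'M[R]_(m * n)) : Prop :=
  [/\ psdmx W,
      loewner_le (\sum_(i < m) mxblk W i i) 1%:M
    & forall j j' : 'I_m, \tr (mxblk W j j') = (j == j')%:R].

Definition sdp_optimal n m (A W : 'M[R]_(m * n)) : Prop :=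
  sdp_feasible W /\
  forall W', sdp_feasible W' -> frobenius A W' <= frobenius A W.

End semidefinite_program.

Section gaussian.
Context {R : realType}.

(* Univariate centered normal law with variance v. The case v = 0 is treated
   apart because normal_prob with null standard deviation is by convention
   uniform on [0, 1], not a Dirac mass. *)
Definition normal0 (v : R) (B : set R) : \bar R :=
  if v == 0 then \d_(0 : R) B else normal_prob 0 (Num.sqrt v) B.

(* mu is the law N(0, S), possibly degenerate: every linear form a^T x is
   a centered univariate normal with variance a^T S a. *)
Definition centered_gaussian k (mu : set 'cV[R]_k -> \bar R) (S : 'M[R]_k) :
    Prop :=
  forall (a : 'cV[R]_k) (B : set R), measurable B ->
    mu [set x | B ((a^T *m x) 0 0)] = normal0 ((a^T *m S *m a) 0 0) B.

End gaussian.

Definition is_svd (R : realType) n m (M U : 'M[R]_(n, m)) (S V : 'M[R]_m) :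
    Prop :=
  [/\ U^T *m U = 1%:M,
      is_diag_mx S /\ (forall i, 0 <= S i i),
      V^T *m V = 1%:M
    & M = U *m S *m V^T].

(* Main.v *)
(** Write [W = E vec G vec G^T], so that [E G^T G = 1] and [E G G^T <= 1]; let
    [Q] be the polar factor of [G] and [c = 1 / sqrt 3].

    Wick's formula gives [E (G^T G)^2 <= 3 E G^T G], and likewise for [G^T].
    Applying [s >= (sqrt 3 / 2) s^2 - (sqrt 3 / 18) s^4] to the singular values
    then yields [E G^T Q >= c E G^T G] and [E G Q^T >= c E G G^T].

    Hence moving [G] to [G - e (Q - c G)] keeps the second moment feasible up to
    a factor [1 + O(e^2)].  Optimality of [W] therefore forces
    [E (q - c g)^T A g >= 0], where [q = vec Q] and [g = vec G]: this replaces
    the use of SDP duality.  Finally [E (q - c g)^T A (q - c g) >= 0] gives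
    [E q^T A q >= 2 c E q^T A g - c^2 E g^T A g >= c^2 <A, W>]. *)

Require Import Defs.
From HB Require Import structures.
From mathcomp Require Import all_boot all_order all_algebra.
From mathcomp Require Import all_classical all_reals all_analysis.
From mathcomp Require Import measurable_realfun.
From mathcomp Require Import ring lra.
Import Order.TTheory GRing.Theory Num.Theory.
Import numFieldNormedType.Exports.

Set Implicit Arguments.
Unset Strict Implicit.
Unset Printing Implicit Defensive.

(** The numerical constants solve one small optimisation. A polynomial [al * s ^+ 2 - be * s ^+ 4]
    tangent to [s] at [tau > 0] has [al = 3 / (2 * tau)] and [be = 1 / (2 * tau ^+ 3)]. Since the
    fourth moment costs a factor 3, what remains is [al - 3 * be], which is largest at
    [tau = sqrt 3], with value [1 / sqrt 3]. That factor 3 counts the Wick pairings, each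
    contributing at most [E G^T G] in the Loewner order.

    A single direction moves both constraints, so the same [c] must serve for [G^T G] and [G G^T].
    It does, because the polar factor of [G^T] is [Q^T] and the fourth moment bound treats the two
    sides alike.

    The program prescribes the block traces exactly, whereas the perturbed second moment only meets
    them as an inequality. Optimality is therefore first extended to this larger feasible set; this
    is where [m <= n] and the positivity of [A] enter.

    As [W] may be degenerate, no joint density is available: the law is known through its linear
    forms only, and joint moments are recovered from univariate ones by polarisation. *)

Local Open Scope classical_set_scope.
Local Open Scope ring_scope.

(** * Gaussian moments *)

Section gaussian_moments.
Context {R : realType}.
Let mu := @lebesgue_measure R.
Import gauss_integral_proof.

Lemma is_derive_gauss_fun (x : R) : is_derive x 1 gauss_fun (- (2 * x) * gauss_fun x).
Proof.
rewrite /gauss_fun.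
have : is_derive x 1 (fun x : R => - x ^+ 2) (- (2 * x)).
  apply: is_derive_eq.
  by rewrite /GRing.scale /=; ring.
move=> h; apply: is_derive_eq.
by rewrite /GRing.scale /=; ring.
Qed.

Lemma cvg_integral0_gauss : @integral0_gauss R x @[x --> +oo] --> Num.sqrt pi / 2.
Proof.
have : Num.sqrt (@integral0_gauss R x ^+ 2) @[x --> +oo] --> Num.sqrt (pi / 4).
  apply: continuous_cvg; [exact: sqrt_continuous|exact: cvg_integral0_gauss_sqr].
rewrite sqrtrM ?pi_ge0// sqrtrV// (_ : 4 = 2 ^+ 2); last by rewrite expr2 -natrM.
rewrite sqrtr_sqr ger0_norm//; apply: cvg_trans; apply: near_eq_cvg.
by near=> x; rewrite sqrtr_sqr ger0_norm// integral0_gauss_ge0.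
Unshelve. all: by end_near. Qed.

Lemma is_derive_integral0_gauss (x : R) : 0 < x ->
  is_derive x 1 (@integral0_gauss R) (gauss_fun x).
Proof.
move=> x0.
have gi : mu.-integrable `[0, x + 1] (EFin \o gauss_fun).
  apply: continuous_compact_integrable; first exact: segment_compact.
  by apply: continuous_subspaceT; exact: continuous_gauss_fun.
have xx1 : x < x + 1 by rewrite ltrDl.
have [dI <-] := continuous_FTC1_closed xx1 gi x0 (@continuous_gauss_fun R x).
by rewrite derive1E; apply/DeriveDef.
Qed.

(** For [x >= 1], one term of the exponential series bounds [expR (x ^+ 2)] below by
    [x ^+ n.+1 / (n+1)!], so the product is at most [(n+1)! / x]. *)
Lemma cvg_exprM_gauss_fun n : x ^+ n * gauss_fun x @[x --> +oo] --> (0 : R).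
Proof.
apply: (@squeeze_cvgr _ _ _ _ (cst 0) (fun x => n.+1`!%:R / x)).
- near=> x.
  have x1 : 1 <= x by near: x; exact: nbhs_pinfty_ge.
  have x0 : 0 < x by exact: lt_le_trans x1.
  apply/andP; split => /=.
    by rewrite mulr_ge0 ?exprn_ge0 ?gauss_fun_ge0 ?ltW.
  rewrite /gauss_fun expRN ler_pdivrMr ?expR_gt0// mulrAC ler_pdivlMr// -exprSr.
  have h : 1 + x ^+ n.+1 / n.+1`!%:R <= expR (x ^+ 2).
    apply: le_trans (expR_ge1Dxn n (sqr_ge0 x)).
    rewrite lerD2l ler_pM2r ?invr_gt0 ?ltr0n ?fact_gt0//.
    by rewrite -exprM ler_weXn2l// mul2n -addnn leq_addr.
  rewrite -ler_pdivrMl ?ltr0n ?fact_gt0// mulrC; apply: le_trans h.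
  by rewrite lerDr.
- exact: cvg_cst.
- rewrite -(mulr0 (n.+1`!%:R)); apply: cvgMr.
  by apply/gtr0_cvgV0; [exact: nbhs_pinfty_gt|exact: cvg_id].
Unshelve. all: by end_near. Qed.

(** Evenness doubles the integral over the half-line, where the fundamental theorem of calculus
    applies. Derivatives are asked at positive points and a one-sided limit at 0, which is the form
    in which [integral0_gauss] is available. *)
Lemma integral_even_primitive (f F : R -> R) (l : R) :
  (forall x, 0 <= f x) -> continuous f -> (forall x, f (- x) = f x) ->
  F x @[x --> +oo] --> l ->
  (forall x : R, 0 < x -> derivable F x 1 /\ 'D_1 F x = f x) ->
  F x @[x --> 0^'+] --> F 0 ->
  (\int[mu]_x (f x)%:E = (2 * (l - F 0))%:E)%E.
Proof.
move=> f0 cf fN Fl dF F0.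
rewrite ge0_symfun_integralT//; last by move=> x /=; rewrite fN.
rewrite -set_itvcy (@ge0_continuous_FTC2y R f F 0 l)//.
- exact: continuous_subspaceT.
- by move=> x x0; case: (dF x x0).
- move=> x; rewrite in_itv/= andbT => x0.
  by rewrite derive1E; case: (dF x x0).
Qed.

Lemma cvg_integral0_gauss0 : @integral0_gauss R x @[x --> 0^'+] --> integral0_gauss 0.
Proof.
have gi : mu.-integrable `[0, 1] (EFin \o gauss_fun).
  apply: continuous_compact_integrable; first exact: segment_compact.
  by apply: continuous_subspaceT; exact: continuous_gauss_fun.
have := @parameterized_integral_continuous R 0 1 gauss_fun ler01 gi.
by move/continuous_within_itvP => /(_ ltr01)[].
Qed.

Lemma integral0_gauss0 : @integral0_gauss R 0 = 0.
Proof. by rewrite /integral0_gauss set_itv1 Rintegral_set1. Qed.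

Lemma integral_gauss2 :
  (\int[mu]_x (x ^+ 2 * gauss_fun x)%:E = (Num.sqrt pi / 2)%:E)%E.
Proof.
(* Integration by parts of [x * (x * gauss_fun x)]. *)
pose F (x : R) := 2^-1 * (integral0_gauss x - x ^+ 1 * gauss_fun x).
rewrite (@integral_even_primitive _ F (2^-1 * (Num.sqrt pi / 2 - 0))).
- by congr EFin; rewrite /F integral0_gauss0 expr1 mul0r !subr0 mulr0 subr0; field.
- by move=> x; rewrite mulr_ge0 ?sqr_ge0 ?gauss_fun_ge0.
- by move=> x; apply: cvgM; [exact: exprn_continuous|exact: continuous_gauss_fun].
- by move=> x; rewrite /gauss_fun !sqrrN.
- apply: cvgMr; apply: cvgB; [exact: cvg_integral0_gauss|exact: cvg_exprM_gauss_fun].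
- move=> x x0; have d1 := is_derive_integral0_gauss x0.
  have d2 := is_derive_gauss_fun x.
  suff [] : is_derive x 1 F (x ^+ 2 * gauss_fun x) by [].
  by apply: is_derive_eq; rewrite /GRing.scale/=; field.
- apply: cvgMr; apply: cvgB; first exact: cvg_integral0_gauss0.
  apply: cvgM; last by apply: cvg_at_right_filter; exact: continuous_gauss_fun.
  by apply: cvg_at_right_filter; exact: exprn_continuous.
Qed.

Lemma integral_gauss4 :
  (\int[mu]_x (x ^+ 4 * gauss_fun x)%:E = (3 * Num.sqrt pi / 4)%:E)%E.
Proof.
(* Integration by parts of [x ^+ 3 * (x * gauss_fun x)], followed by the primitive found for the
   second moment. *)
pose F (x : R) := 3 / 4 * (integral0_gauss x - x ^+ 1 * gauss_fun x) -
   2^-1 * (x ^+ 3 * gauss_fun x).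
rewrite (@integral_even_primitive _ F
  (3 / 4 * (Num.sqrt pi / 2 - 0) - 2^-1 * 0)).
- by congr EFin; rewrite /F integral0_gauss0 expr0n/= !mul0r; field.
- by move=> x; rewrite mulr_ge0 ?gauss_fun_ge0// exprn_even_ge0.
- by move=> x; apply: cvgM; [exact: exprn_continuous|exact: continuous_gauss_fun].
- by move=> x; rewrite /gauss_fun sqrrN; congr (_ * _); ring.
- apply: cvgB; apply: cvgMr; last exact: cvg_exprM_gauss_fun.
  by apply: cvgB; [exact: cvg_integral0_gauss|exact: cvg_exprM_gauss_fun].
- move=> x x0; have d1 := is_derive_integral0_gauss x0.
  have d2 := is_derive_gauss_fun x.
  suff [] : is_derive x 1 F (x ^+ 4 * gauss_fun x) by [].
  by apply: is_derive_eq; rewrite /GRing.scale/=; field.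
- have cX k : (x ^+ k * gauss_fun x @[x --> 0^'+] --> (0 : R) ^+ k * gauss_fun 0).
    by apply: cvgM; apply: cvg_at_right_filter;
      [exact: exprn_continuous|exact: continuous_gauss_fun].
  by apply: cvgB; apply: cvgMr => //; apply: cvgB => //; exact: cvg_integral0_gauss0.
Qed.

End gaussian_moments.

Section normal_integral.
Context {R : realType}.
Let mu := @lebesgue_measure R.
Local Open Scope ereal_scope.

(** The change of variables formula is stated for the Radon-Nikodym derivative, which agrees almost
    everywhere with [normal_pdf] since both have the same integrals over measurable sets. *)
Lemma ge0_integral_normal_prob (m s : R) (f : measurableTypeR R -> \bar R) :
  (forall x, 0 <= f x) -> measurable_fun setT f ->
  \int[normal_prob m s]_x f x = \int[mu]_x (f x * (normal_pdf m s x)%:E).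
Proof.
move=> f0 mf.
have dom := normal_prob_dominates m s.
rewrite -(Radon_Nikodym_SigmaFinite.change_of_variables dom)//.
have iRN := Radon_Nikodym_SigmaFinite.f_integrable dom.
apply: ae_eq_integral => //.
- by apply: emeasurable_funM => //; exact: measurable_int iRN.
- apply: emeasurable_funM => //; apply/measurable_EFinP.
  exact: measurable_normal_pdf.
- apply: ae_eqe_mul2l => /=; apply: integral_ae_eq => //.
  + by apply/measurable_EFinP; exact: measurable_normal_pdf.
  + by move=> A _ mA; rewrite -Radon_Nikodym_SigmaFinite.f_integral.
Qed.

(** Variance 1/2 makes the exponent exactly [- x ^+ 2]. It is the reference law for all moments;
    other positive variances are reached by scaling. *)
Lemma normal_pdf_half (x : R) :
  normal_pdf 0 (Num.sqrt 2^-1) x = ((Num.sqrt pi)^-1 * gauss_fun x)%R :> R.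
Proof.
have s2 : (Num.sqrt 2^-1 ^+ 2 = 2^-1 :> R)%R by rewrite sqr_sqrtr.
rewrite normal_pdfE ?gt_eqF ?sqrtr_gt0//.
rewrite /normal_peak /normal_fun s2 subr0 /gauss_fun; congr (_^-1 * expR _)%R.
- by congr Num.sqrt; field.
- by field.
Qed.

Lemma normal_half_moment (k : nat) (c : R) :
  \int[mu]_x ((x ^+ (2 * k) * gauss_fun x)%R)%:E = (Num.sqrt pi * c)%:E ->
  \int[normal_prob 0 (Num.sqrt 2^-1)]_x ((x ^+ (2 * k))%R)%:E = c%:E.
Proof.
move=> h.
have x0 (x : R) : (0 <= x ^+ (2 * k))%R by rewrite exprn_even_ge0// oddM.
rewrite ge0_integral_normal_prob; last 2 first.
- by move=> x; rewrite lee_fin.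
- by apply/measurable_EFinP; exact: exprn_measurable.
under eq_integral => x _ do rewrite normal_pdf_half -EFinM mulrCA EFinM.
rewrite ge0_integralZl//=.
- rewrite h -EFinM mulKf// gt_eqF// sqrtr_gt0 pi_gt0//.
- apply/measurable_EFinP/measurable_funM; first exact: exprn_measurable.
  exact: measurable_gauss_fun.
- by move=> x _; rewrite lee_fin mulr_ge0// gauss_fun_ge0.
Qed.

End normal_integral.

Section gaussian_forms.
Context {R : realType} d (T : measurableType d) (P : probability T R).
Local Open Scope ereal_scope.

Lemma normal0_half_moment (X : T -> R) (k : nat) (c : R) :
  measurable_fun setT X ->
  (forall B, measurable B -> P (X @^-1` B) = normal0 2^-1%R B) ->
  \int[@lebesgue_measure R]_x ((x ^+ (2 * k) * gauss_fun x)%R)%:E =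
    (Num.sqrt pi * c)%:E ->
  \int[P]_w ((X w ^+ (2 * k))%R)%:E = c%:E.
Proof.
move=> mX hX hc.
pose X' : {mfun T >-> measurableTypeR R} :=
  HB.pack (X : T -> measurableTypeR R)
    (isMeasurableFun.Build _ _ T (measurableTypeR R) X mX).
rewrite -(normal_half_moment hc).
transitivity (\int[distribution P X']_x ((x ^+ (2 * k))%R)%:E).
  rewrite ge0_integral_distribution//.
  - by apply/measurable_EFinP; exact: exprn_measurable.
  - by move=> x; rewrite lee_fin exprn_even_ge0// oddM.
apply: (@eq_measure_integral _ (measurableTypeR R) R setT
  (normal_prob 0 (Num.sqrt 2^-1)) (distribution P X')) => A mA _.
rewrite [LHS](hX A mA) /normal0 ifF//.
by rewrite gt_eqF.
Qed.

End gaussian_forms.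

(** * Positive semidefinite matrices *)

Section psd.
Context {R : realType}.

Lemma psdmx_tr k (X : 'M[R]_k) : psdmx X -> X^T = X.
Proof. by case. Qed.

Lemma psdmx0 k : psdmx (0 : 'M[R]_k).
Proof. by split=> [|x]; rewrite ?trmx0// mulmx0 mul0mx mxE. Qed.

Lemma psdmxD k (X Y : 'M[R]_k) : psdmx X -> psdmx Y -> psdmx (X + Y).
Proof.
move=> [sX pX] [sY pY]; split=> [|x]; first by rewrite linearD/= sX sY.
by rewrite mulmxDr mulmxDl mxE addr_ge0.
Qed.

Lemma psdmxZ k (a : R) (X : 'M[R]_k) : 0 <= a -> psdmx X -> psdmx (a *: X).
Proof.
move=> a0 [sX pX]; split=> [|x]; first by rewrite linearZ/= sX.
by rewrite -scalemxAr -scalemxAl mxE mulr_ge0.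
Qed.

Lemma psdmx_sum k (I : finType) (F : I -> 'M[R]_k) :
  (forall i, psdmx (F i)) -> psdmx (\sum_i F i).
Proof.
move=> hF; elim/big_ind : _ => //; [exact: psdmx0|].
by move=> X Y; exact: psdmxD.
Qed.

Lemma psdmx_congr k l (X : 'M[R]_k) (B : 'M[R]_(k, l)) :
  psdmx X -> psdmx (B^T *m X *m B).
Proof.
move=> [sX pX]; split=> [|x]; first by rewrite !trmx_mul trmxK sX mulmxA.
by have := pX (B *m x); rewrite trmx_mul !mulmxA.
Qed.

Lemma psdmx1 k : psdmx (1%:M : 'M[R]_k).
Proof.
split=> [|x]; rewrite ?trmx1// mulmx1 mxE sumr_ge0// => i _.
by rewrite mxE -expr2 sqr_ge0.
Qed.

Lemma psdmx_gram k l (B : 'M[R]_(k, l)) : psdmx (B^T *m B).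
Proof. by rewrite -[B^T]mulmx1; apply/psdmx_congr/psdmx1. Qed.

Lemma psdmx_scalar k (a : R) : 0 <= a -> psdmx (a%:M : 'M[R]_k).
Proof. by move=> a0; rewrite -scalemx1; apply/psdmxZ/psdmx1. Qed.

Lemma psdmx_diag k (d : 'rV[R]_k) : (forall i, 0 <= d 0 i) -> psdmx (diag_mx d).
Proof.
move=> d0; split=> [|x]; first by rewrite tr_diag_mx.
rewrite -mulmxA mul_diag_mx mxE sumr_ge0// => i _.
by rewrite !mxE mulrCA mulr_ge0// -expr2 sqr_ge0.
Qed.

Lemma psdmx_diag_ge0 k (X : 'M[R]_k) i : psdmx X -> 0 <= X i i.
Proof.
move=> [_ /(_ (delta_mx i 0))].
rewrite trmx_delta -rowE mxE (bigD1 i)//= big1 => [|j ji].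
  by rewrite !mxE !eqxx mulr1 addr0.
by rewrite !mxE (negbTE ji) mulr0.
Qed.

Lemma psdmx_trace_ge0 k (X : 'M[R]_k) : psdmx X -> 0 <= \tr X.
Proof. by move=> pX; rewrite sumr_ge0// => i _; exact: psdmx_diag_ge0. Qed.

Lemma loewner_refl k (X : 'M[R]_k) : loewner_le X X.
Proof. by rewrite /loewner_le subrr; exact: psdmx0. Qed.

Lemma loewner_trans k (Y X Z : 'M[R]_k) :
  loewner_le X Y -> loewner_le Y Z -> loewner_le X Z.
Proof.
rewrite /loewner_le => XY YZ; rewrite -[Z - X](subrKA Y).
exact: psdmxD.
Qed.

Lemma loewnerD k (X Y X' Y' : 'M[R]_k) :
  loewner_le X Y -> loewner_le X' Y' -> loewner_le (X + X') (Y + Y').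
Proof. by rewrite /loewner_le opprD addrACA; exact: psdmxD. Qed.

Lemma loewnerZ k (a : R) (X Y : 'M[R]_k) :
  0 <= a -> loewner_le X Y -> loewner_le (a *: X) (a *: Y).
Proof. by rewrite /loewner_le -scalerBr; exact: psdmxZ. Qed.

Lemma loewner_sum k (I : finType) (F F' : I -> 'M[R]_k) :
  (forall i, loewner_le (F i) (F' i)) -> loewner_le (\sum_i F i) (\sum_i F' i).
Proof. by move=> h; rewrite /loewner_le -sumrB; exact: psdmx_sum. Qed.

Lemma loewner_congr k l (X Y : 'M[R]_k) (B : 'M[R]_(k, l)) :
  loewner_le X Y -> loewner_le (B^T *m X *m B) (B^T *m Y *m B).
Proof. by rewrite /loewner_le -mulmxBl -mulmxBr; exact: psdmx_congr. Qed.

Lemma loewner_trace k (X Y : 'M[R]_k) : loewner_le X Y -> \tr X <= \tr Y.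
Proof. by move=> /psdmx_trace_ge0; rewrite linearB/= subr_ge0. Qed.

(** The identity [X - X^2 = (1 - X) X (1 - X) + X (1 - X) X] exhibits the difference as a sum of two
    congruences, so no diagonalisation is required. *)
Lemma loewner_sqr k (X : 'M[R]_k) :
  psdmx X -> loewner_le X 1%:M -> loewner_le (X *m X) X.
Proof.
move=> pX p1X; rewrite /loewner_le.
suff -> : X - X *m X = (1%:M - X)^T *m X *m (1%:M - X) + X^T *m (1%:M - X) *m X.
  by apply: psdmxD; exact: psdmx_congr.
rewrite (psdmx_tr p1X) (psdmx_tr pX) !(mulmxBl, mulmxBr, mul1mx, mulmx1).
by rewrite subrK.
Qed.

(** The sum of the absolute entries works, as each [x i 0 * x j 0] is at most the squared norm of
    [x] in absolute value. The bound is stated for all larger [b] so that two matrices can share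
    one. *)
Lemma loewner_scalar_bound k (X : 'M[R]_k) : X^T = X ->
  exists a : R, forall b, a <= b -> loewner_le X b%:M.
Proof.
move=> sX; exists (\sum_i \sum_j `|X i j|) => b ab; split.
  by rewrite linearB/= tr_scalar_mx sX.
move=> x; rewrite mulmxBr mulmxBl mul_mx_scalar -scalemxAl !mxE subr_ge0.
set N := \sum_j x^T 0 j * x j 0.
have xN i : x i 0 ^+ 2 <= N.
  rewrite /N (bigD1 i)//= mxE -expr2 lerDl sumr_ge0// => j _.
  by rewrite mxE -expr2 sqr_ge0.
have N0 : 0 <= N by rewrite sumr_ge0// => j _; rewrite mxE -expr2 sqr_ge0.
apply: (@le_trans _ _ ((\sum_i \sum_j `|X i j|) * N)); last by rewrite ler_wpM2r.
rewrite [leRHS](_ : _ = (\sum_j \sum_i `|X i j|) * N); last by rewrite exchange_big.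
rewrite mulr_suml; apply: ler_sum => j _.
rewrite mxE !mulr_suml; apply: ler_sum => i _.
rewrite mxE (_ : _ * _ = X i j * (x i 0 * x j 0)); last by ring.
rewrite (le_trans (ler_norm _))// !normrM; apply: ler_wpM2l => //.
have := xN i; have := xN j; rewrite -(real_normK (num_real (x i 0))).
rewrite -(real_normK (num_real (x j 0))).
nra.
Qed.

(** Induction on the size through the Schur complement of the first pivot [a]. The pivot may vanish;
    then the rest of its row vanishes too, and the convention [0^-1 = 0] lets one formula cover both
    cases. *)
Lemma psdmx_cholesky k (X : 'M[R]_k) : psdmx X -> exists B : 'M[R]_k, X = B^T *m B.
Proof.
elim: k X => [|k IH] X; first by exists 0; apply/matrixP => -[].
rewrite -[k.+1]/(1 + k)%N in X * => -[sX pX].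
pose a := X 0 0; pose v : 'rV_k := ursubmx X; pose Y := drsubmx X.
have XE : X = block_mx a%:M v v^T Y.
  rewrite -[LHS]submxK; congr block_mx.
  - by apply/matrixP => i j; rewrite !ord1 !mxE lshift0.
  - by rewrite /v trmx_ursub sX.
have sY : Y^T = Y by rewrite /Y trmx_drsub sX.
have age0 : 0 <= a by have := psdmx_diag_ge0 0 (conj sX pX).
clearbody a v Y.
(* The quadratic form at the vector with first coordinate [t] and remaining part [y]; the rest of
   the argument chooses [t]. *)
have q t (y : 'cV_k) : 0 <= a * t ^+ 2 + 2 * t * (v *m y) 0 0 + (y^T *m Y *m y) 0 0.
  have := pX (col_mx t%:M y).
  rewrite XE tr_col_mx mul_row_block mul_row_col !mulmxDl tr_scalar_mx.
  have vy : v *m y = ((v *m y) 0 0)%:M by exact: mx11_scalar.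
  rewrite -trmx_mul -(mulmxA _ v y) vy tr_scalar_mx -!scalar_mxM.
  move: ((v *m y) 0 0) (y^T *m Y *m y) => b C.
  rewrite !mxE eqxx !mulr1n.
  by lra.
have v0 : v = (a * a^-1) *: v.
  have [a0|a0] := eqVneq a 0; last by rewrite divff// scale1r.
  rewrite a0 mul0r scale0r; pose N := (v *m v^T) 0 0; pose c := (v *m Y *m v^T) 0 0.
  have NE : N = \sum_i v 0 i ^+ 2.
    by rewrite /N mxE; apply: eq_bigr => i _; rewrite [v^T _ _]mxE expr2.
  have N0 : 0 <= N by rewrite NE sumr_ge0// => i _; rewrite sqr_ge0.
  have {}N0 : N = 0.
    apply/eqP; rewrite eq_le N0 andbT leNgt; apply/negP => Npos.
    (* With a zero pivot the form is affine in [t], namely [2 * t * N + c]. This [t] makes it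
       [- c - 2], which is negative because [c >= 0]. *)
    have := q (- (c + 1) / N) v^T; rewrite a0 mul0r add0r trmxK -/N -/c.
    have -> : 2 * (- (c + 1) / N) * N = - (2 * (c + 1)) by field; rewrite gt_eqF.
    by have := q 0 v^T; rewrite trmxK -/c; lra.
  apply/rowP => i; rewrite mxE; apply/eqP; rewrite -sqrf_eq0.
  move: N0; rewrite NE => /eqP.
  rewrite psumr_eq0 => [/allP/(_ i)|j _]; last exact: sqr_ge0.
  by rewrite mem_index_enum => /(_ isT).
pose Z := Y - a^-1 *: (v^T *m v).
have pZ : psdmx Z.
  split=> [|y]; first by rewrite linearB/= linearZ/= trmx_mul trmxK sY.
  have vy : v *m y = ((v *m y) 0 0)%:M by exact: mx11_scalar.
  have E : y^T *m (v^T *m v) *m y = ((v *m y) 0 0 * (v *m y) 0 0)%:M.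
    rewrite (_ : _ *m y = (v *m y)^T *m (v *m y)); last by rewrite trmx_mul !mulmxA.
    by rewrite vy tr_scalar_mx -scalar_mxM !mxE eqxx !mulr1n.
  rewrite mulmxBr mulmxBl -scalemxAr -scalemxAl E.
  (* The minimiser in [t] when [a != 0]: the minimum is the Schur complement form. *)
  have := q (- a^-1 * (v *m y) 0 0) y.
  move: ((v *m y) 0 0) (y^T *m Y *m y) => b C.
  rewrite !mxE eqxx !mulr1n; move: (C 0 0) => c.
  have [->|a1] := eqVneq a 0; first by rewrite invr0; nra.
  suff -> : a * (- a^-1 * b) ^+ 2 + 2 * (- a^-1 * b) * b + c = c - a^-1 * (b * b) by [].
  by field.
have [B ZE] := IH _ pZ.
exists (block_mx (Num.sqrt a)%:M ((Num.sqrt a)^-1 *: v) 0 B).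
rewrite tr_block_mx mulmx_block XE trmx0 !mulmx0 !mul0mx !addr0 -ZE.
rewrite tr_scalar_mx -scalar_mxM -expr2 sqr_sqrtr//.
have sa : Num.sqrt a * (Num.sqrt a)^-1 = a * a^-1.
  have [->|a1] := eqVneq a 0; first by rewrite sqrtr0 !mul0r.
  by rewrite !divff// sqrtr_eq0 -ltNge lt_neqAle eq_sym a1.
rewrite mul_scalar_mx scalerA sa -v0 mul_mx_scalar linearZ/= scalerA sa.
rewrite -[(a / a) *: v^T]linearZ/= -v0; congr block_mx.
rewrite -scalemxAl -scalemxAr scalerA -invfM -expr2 sqr_sqrtr//.
by rewrite addrC subrK.
Qed.

End psd.

(** * Expectation of random matrices *)

Section expectation.
Context {R : realType} d (T : measurableType d) (P : probability T R).
Implicit Types X Y : T -> R.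

(** Real-valued, so that matrices of expectations can be formed. An infinite expectation is sent to
    0 by [fine], hence the integrability conditions in the linearity rules. *)
Definition expect X : R := fine ('E_P[X])%E.
Local Notation Ex := expect.

Definition L1 X := X \in Lfun P 1.
Definition L2 X := X \in Lfun P 2%:E.

Lemma L1D X Y : L1 X -> L1 Y -> L1 (fun w => X w + Y w).
Proof. exact: (Lfun_addr_closed P (lexx 1%E)).2. Qed.

Lemma L1Z c X : L1 X -> L1 (fun w => c * X w).
Proof.
have [z sm] := Lfun_submod_closed P (lexx 1%E) => hX.
by have := sm c X 0 hX z; rewrite addr0.
Qed.

Lemma L2D X Y : L2 X -> L2 Y -> L2 (fun w => X w + Y w).
Proof. exact: (Lfun_addr_closed P (lee1n 2)).2. Qed.

Lemma L2Z c X : L2 X -> L2 (fun w => c * X w).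
Proof.
have [z sm] := Lfun_submod_closed P (lee1n 2) => hX.
by have := sm c X 0 hX z; rewrite addr0.
Qed.

Lemma L2M X Y : L2 X -> L2 Y -> L1 (fun w => X w * Y w).
Proof. exact: Lfun2_mul_Lfun1. Qed.

Lemma L1P X : L1 X <-> P.-integrable setT (EFin \o X).
Proof. exact: Lfun1_integrable. Qed.

Lemma L2P X : measurable_fun setT X -> L1 (fun w => X w ^+ 2) -> L2 X.
Proof.
move=> mX /L1P/integrableP[_ h].
rewrite /L2 inE; apply/andP; split; rewrite inE//= /finite_norm unlock /Lnorm.
rewrite poweR_lty//; apply: le_lt_trans h; rewrite le_eqVlt; apply/orP; left.
apply/eqP/eq_integral => w _ /=.
by rewrite powR_mulrn// normrX.
Qed.

Lemma L1_sum (I : finType) (F : I -> T -> R) :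
  (forall i, L1 (F i)) -> L1 (fun w => \sum_i F i w).
Proof.
move=> hF; rewrite (_ : (fun w => _) = \sum_i F i); last first.
  by apply/funext => w; rewrite fct_sumE.
elim/big_ind : _ => //; first exact: (Lfun_addr_closed P (lexx 1%E)).1.
by move=> X Y; exact: L1D.
Qed.

Lemma L2_sum (I : finType) (F : I -> T -> R) :
  (forall i, L2 (F i)) -> L2 (fun w => \sum_i F i w).
Proof.
move=> hF; rewrite (_ : (fun w => _) = \sum_i F i); last first.
  by apply/funext => w; rewrite fct_sumE.
elim/big_ind : _ => //; first exact: (Lfun_addr_closed P (lee1n 2)).1.
by move=> X Y; exact: L2D.
Qed.

Lemma L1_cst c : L1 (fun=> c).
Proof. exact: Lfun_cst. Qed.

Lemma Ex_fin X : L1 X -> ('E_P[X] = (Ex X)%:E)%E.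
Proof. by move=> hX; rewrite fineK//; exact: expectation_fin_num. Qed.

Lemma ExD X Y : L1 X -> L1 Y -> Ex (fun w => X w + Y w) = Ex X + Ex Y.
Proof.
move=> hX hY; rewrite /expect (expectationD hX hY) fineD//; exact: expectation_fin_num.
Qed.

Lemma ExZ c X : L1 X -> Ex (fun w => c * X w) = c * Ex X.
Proof.
move=> hX; rewrite /expect (_ : (fun w => _) = c \o* X); last first.
  by apply/funext => w /=; rewrite mulrC.
by rewrite expectationZl// fineM//; exact: expectation_fin_num.
Qed.

Lemma Ex_cst c : Ex (fun=> c) = c.
Proof. by rewrite /expect expectation_cst. Qed.

Lemma Ex_sum (I : finType) (F : I -> T -> R) :
  (forall i, L1 (F i)) -> Ex (fun w => \sum_i F i w) = \sum_i Ex (F i).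
Proof.
move=> hF.
suff : forall s : seq I, L1 (fun w => \sum_(i <- s) F i w) /\
    Ex (fun w => \sum_(i <- s) F i w) = \sum_(i <- s) Ex (F i).
  by move=> /(_ (index_enum I))[].
elim=> [|i s [h1 h2]].
  under eq_fun do rewrite big_nil.
  by rewrite big_nil Ex_cst; split=> //; exact: L1_cst.
under eq_fun do rewrite big_cons.
by rewrite big_cons ExD// h2; split=> //; exact: L1D.
Qed.

Lemma Ex_ge0 X : (forall w, 0 <= X w) -> 0 <= Ex X.
Proof. by move=> X0; rewrite /expect fine_ge0// expectation_ge0. Qed.

End expectation.

Section matrix_expectation.
Context {R : realType} d (T : measurableType d) (P : probability T R).
Local Notation L1 := (L1 P).
Local Notation L2 := (L2 P).
Local Notation Ex := (expect P).

Definition mEx p q (M : T -> 'M[R]_(p, q)) : 'M[R]_(p, q) :=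
  \matrix_(i, j) Ex (fun w => M w i j).

Definition mL1 p q (M : T -> 'M[R]_(p, q)) := forall i j, L1 (fun w => M w i j).
Definition mL2 p q (M : T -> 'M[R]_(p, q)) := forall i j, L2 (fun w => M w i j).

Lemma mL1D p q (M N : T -> 'M[R]_(p, q)) : mL1 M -> mL1 N -> mL1 (fun w => M w + N w).
Proof. by move=> hM hN i j; under eq_fun do rewrite mxE; exact: L1D. Qed.

Lemma mL2D p q (M N : T -> 'M[R]_(p, q)) : mL2 M -> mL2 N -> mL2 (fun w => M w + N w).
Proof. by move=> hM hN i j; under eq_fun do rewrite mxE; exact: L2D. Qed.

Lemma mL1Z p q c (M : T -> 'M[R]_(p, q)) : mL1 M -> mL1 (fun w => c *: M w).
Proof. by move=> hM i j; under eq_fun do rewrite mxE; exact: L1Z. Qed.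

Lemma mL2Z p q c (M : T -> 'M[R]_(p, q)) : mL2 M -> mL2 (fun w => c *: M w).
Proof. by move=> hM i j; under eq_fun do rewrite mxE; exact: L2Z. Qed.

Lemma mL2_tr p q (M : T -> 'M[R]_(p, q)) : mL2 M -> mL2 (fun w => (M w)^T).
Proof. by move=> hM i j; under eq_fun do rewrite mxE; exact: hM. Qed.

Lemma mL1M p q r (M : T -> 'M[R]_(p, q)) (N : T -> 'M[R]_(q, r)) :
  mL2 M -> mL2 N -> mL1 (fun w => M w *m N w).
Proof.
move=> hM hN i j; under eq_fun do rewrite mxE.
by apply: L1_sum => k; exact: L2M.
Qed.

Lemma mL1_mull p q r (A : 'M[R]_(p, q)) (N : T -> 'M[R]_(q, r)) :
  mL1 N -> mL1 (fun w => A *m N w).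
Proof.
move=> hN i j; under eq_fun do rewrite mxE.
by apply: L1_sum => k; exact: L1Z.
Qed.

Lemma mExD p q (M N : T -> 'M[R]_(p, q)) : mL1 M -> mL1 N ->
  mEx (fun w => M w + N w) = mEx M + mEx N.
Proof.
move=> hM hN; apply/matrixP => i j; rewrite !mxE -ExD//.
by congr Ex; apply/funext => w; rewrite mxE.
Qed.

Lemma mExZ p q c (M : T -> 'M[R]_(p, q)) : mL1 M ->
  mEx (fun w => c *: M w) = c *: mEx M.
Proof.
move=> hM; apply/matrixP => i j; rewrite !mxE -ExZ//.
by congr Ex; apply/funext => w; rewrite mxE.
Qed.

Lemma mEx_tr p q (M : T -> 'M[R]_(p, q)) : mEx (fun w => (M w)^T) = (mEx M)^T.
Proof.
by apply/matrixP => i j; rewrite !mxE; congr Ex; apply/funext => w; rewrite mxE.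
Qed.

Lemma mEx_mull p q r (A : 'M[R]_(p, q)) (N : T -> 'M[R]_(q, r)) : mL1 N ->
  mEx (fun w => A *m N w) = A *m mEx N.
Proof.
move=> hN; apply/matrixP => i j; rewrite !mxE.
under eq_fun do rewrite mxE.
rewrite Ex_sum => [|k]; last exact: L1Z.
by apply: eq_bigr => k _; rewrite ExZ// mxE.
Qed.

Lemma mEx_mulr p q r (A : 'M[R]_(q, r)) (N : T -> 'M[R]_(p, q)) : mL1 N ->
  mEx (fun w => N w *m A) = mEx N *m A.
Proof.
move=> hN; apply/matrixP => i j; rewrite !mxE.
under eq_fun do rewrite mxE.
rewrite Ex_sum => [|k]; last by under eq_fun do rewrite mulrC; exact: L1Z.
apply: eq_bigr => k _; under eq_fun do rewrite mulrC.
by rewrite ExZ// mxE mulrC.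
Qed.

Lemma mEx_trace p (M : T -> 'M[R]_p) : mL1 M -> \tr (mEx M) = Ex (fun w => \tr (M w)).
Proof.
move=> hM; rewrite /mxtrace Ex_sum//.
by apply: eq_bigr => i _; rewrite mxE.
Qed.

Lemma psdmx_mEx p (M : T -> 'M[R]_p) : mL1 M -> (forall w, psdmx (M w)) ->
  psdmx (mEx M).
Proof.
move=> hM pM; split=> [|x].
  by rewrite -mEx_tr; congr mEx; apply/funext => w; rewrite (psdmx_tr (pM w)).
rewrite -mEx_mull// -mEx_mulr; last exact: mL1_mull.
by rewrite mxE; apply: Ex_ge0 => w; have [_] := pM w.
Qed.

Lemma loewner_mEx p (M N : T -> 'M[R]_p) : mL1 M -> mL1 N ->
  (forall w, loewner_le (M w) (N w)) -> loewner_le (mEx M) (mEx N).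
Proof.
move=> hM hN h; rewrite /loewner_le -scaleN1r -mExZ// -mExD//; last exact: mL1Z.
apply: psdmx_mEx => [|w]; first by apply: mL1D => //; exact: mL1Z.
by rewrite scaleN1r; exact: h.
Qed.

End matrix_expectation.

(** * The relaxed semidefinite program *)

Section blocks.
Context {R : realType}.
Variables n m : nat.
Implicit Types (W : 'M[R]_(m * n)) (X Y : 'M[R]_(n, m)).

(** [sumblk] and [trblk] are the two partial traces of [W] on the tensor product of [R^m] and [R^n].
    For a second moment of [vec X] they become the expectations of [X *m X^T] and [X^T *m X], which
    turns both constraints into statements about [X]. *)
Definition sumblk W : 'M[R]_n := \sum_(i < m) mxblk W i i.
Definition trblk W : 'M[R]_m := \matrix_(j, j') \tr (mxblk W j j').

Lemma vecE X i j : vec X (mxvec_index j i) 0 = X i j.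
Proof. by rewrite /vec mxE mxvecE mxE. Qed.

Lemma sumblkD W W' : sumblk (W + W') = sumblk W + sumblk W'.
Proof.
rewrite /sumblk -big_split; apply: eq_bigr => i _.
by apply/matrixP => k l; rewrite !mxE.
Qed.

Lemma sumblkZ a W : sumblk (a *: W) = a *: sumblk W.
Proof.
rewrite /sumblk scaler_sumr; apply: eq_bigr => i _.
by apply/matrixP => k l; rewrite !mxE.
Qed.

Lemma trblkD W W' : trblk (W + W') = trblk W + trblk W'.
Proof.
apply/matrixP => j j'; rewrite !mxE -big_split/=.
by apply: eq_bigr => i _; rewrite !mxE.
Qed.

Lemma trblkZ a W : trblk (a *: W) = a *: trblk W.
Proof.
by apply/matrixP => j j'; rewrite !mxE mulr_sumr; apply: eq_bigr => i _; rewrite !mxE.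
Qed.

Lemma sumblk_sum (I : finType) (F : I -> 'M[R]_(m * n)) :
  sumblk (\sum_i F i) = \sum_i sumblk (F i).
Proof.
apply: (big_morph sumblk sumblkD).
by rewrite -[0](scale0r 0) sumblkZ scale0r.
Qed.

Lemma trblk_sum (I : finType) (F : I -> 'M[R]_(m * n)) :
  trblk (\sum_i F i) = \sum_i trblk (F i).
Proof.
apply: (big_morph trblk trblkD).
by rewrite -[0](scale0r 0) trblkZ scale0r.
Qed.

Lemma trace_sumblk W : \tr (sumblk W) = \tr (trblk W).
Proof.
by rewrite linear_sum/=; apply: eq_bigr => i _; rewrite mxE.
Qed.

Lemma sumblk_outer X : sumblk (vec X *m (vec X)^T) = X *m X^T.
Proof.
apply/matrixP => k l; rewrite summxE !mxE; apply: eq_bigr => i _.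
rewrite [mxblk _ _ _ _ _]mxE [(_ *m _) _ _]mxE big_ord1.
by rewrite [(vec X)^T _ _]mxE !vecE [X^T _ _]mxE.
Qed.

Lemma trblk_outer X : trblk (vec X *m (vec X)^T) = X^T *m X.
Proof.
apply/matrixP => j j'; rewrite !mxE; apply: eq_bigr => i _.
rewrite [mxblk _ _ _ _ _]mxE [(_ *m _) _ _]mxE big_ord1.
by rewrite [(vec X)^T _ _]mxE !vecE [X^T _ _]mxE.
Qed.

Lemma frobenius_outer (A : 'M[R]_(m * n)) X : A^T = A ->
  frobenius A (vec X *m (vec X)^T) = ((vec X)^T *m A *m vec X) 0 0.
Proof. by move=> sA; rewrite /frobenius sA mulmxA mxtrace_mulC mulmxA trace_mx11. Qed.

End blocks.

Section relaxed_optimality.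
Context {R : realType}.
Variables n m : nat.

Lemma frobeniusD p q (A W W' : 'M[R]_(p, q)) :
  frobenius A (W + W') = frobenius A W + frobenius A W'.
Proof. by rewrite /frobenius mulmxDr linearD. Qed.

Lemma frobeniusZ p q (A W : 'M[R]_(p, q)) a : frobenius A (a *: W) = a * frobenius A W.
Proof. by rewrite /frobenius -scalemxAr linearZ. Qed.

Lemma frobenius_sum p q (A : 'M[R]_(p, q)) (I : finType) F :
  frobenius A (\sum_(i : I) F i) = \sum_i frobenius A (F i).
Proof. by rewrite /frobenius mulmx_sumr linear_sum. Qed.

Lemma gram_sum k l (B : 'M[R]_(k, l)) : B^T *m B = \sum_r (row r B)^T *m row r B.
Proof.
apply/matrixP => i j; rewrite summxE mxE; apply: eq_bigr => r _.
by rewrite [RHS]mxE big_ord1 !mxE.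
Qed.

(* Missing mass [D] in the trace constraint is restored by adding a positive
   multiple of the Kronecker product of [D] with the slack [K] of the other
   constraint; the objective does not decrease because [A] is psd. *)
Lemma sdp_relaxed_bound (A W W' : 'M[R]_(m * n)) (kap : R) :
  (m <= n)%N -> psdmx A -> sdp_optimal A W -> 0 < kap -> psdmx W' ->
  loewner_le (sumblk W') kap%:M -> loewner_le (trblk W') kap%:M ->
  \tr (sumblk W') < kap * n%:R ->
  frobenius A W' <= kap * frobenius A W.
Proof.
move=> mn pA [_ optW] kap0 pW' pK pD trW'.
have [E KE] := psdmx_cholesky pK; have [B DE] := psdmx_cholesky pD.
set K := kap%:M - sumblk W' in pK KE; set D := kap%:M - trblk W' in pD DE.
(* [vec (X r s)] is the Kronecker product of row [r] of [B] with row [s] of [E], so [N] below is [D]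
   tensor [K], written as a sum of outer products whose partial traces are already known. *)
pose X r s : 'M[R]_(n, m) := (row s E)^T *m row r B.
pose N : 'M[R]_(m * n) := \sum_r \sum_s vec (X r s) *m (vec (X r s))^T.
have trK : \tr K = kap * n%:R - \tr (sumblk W').
  by rewrite /K linearB/= mxtrace_scalar mulr_natr.
have trD : \tr D = kap * m%:R - \tr (sumblk W').
  by rewrite /D linearB/= mxtrace_scalar mulr_natr trace_sumblk.
have trK0 : 0 < \tr K by rewrite trK subr_gt0.
have sN : sumblk N = \tr D *: K.
  rewrite /N sumblk_sum DE (gram_sum B) linear_sum/= scaler_suml; apply: eq_bigr => r _.
  rewrite sumblk_sum KE (gram_sum E) scaler_sumr; apply: eq_bigr => s _.
  rewrite sumblk_outer /X trmx_mul trmxK mulmxA -(mulmxA _ (row r B)).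
  rewrite [row r B *m _]mx11_scalar mul_mx_scalar -scalemxAl mxtrace_mulC.
  by rewrite trace_mx11.
have tN : trblk N = \tr K *: D.
  rewrite /N exchange_big/= trblk_sum KE (gram_sum E) linear_sum/= scaler_suml.
  apply: eq_bigr => s _; rewrite trblk_sum DE (gram_sum B) scaler_sumr.
  apply: eq_bigr => r _; rewrite trblk_outer /X trmx_mul trmxK mulmxA.
  rewrite -(mulmxA _ (row s E)).
  rewrite [row s E *m _]mx11_scalar mul_mx_scalar -scalemxAl mxtrace_mulC.
  by rewrite trace_mx11.
have pN : psdmx N.
  by apply: psdmx_sum => r; apply: psdmx_sum => s;
    rewrite -{1}[vec _]trmxK; exact: psdmx_gram.
have AN0 : 0 <= frobenius A N.
  rewrite frobenius_sum sumr_ge0// => r _; rewrite frobenius_sum sumr_ge0// => s _.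
  by rewrite frobenius_outer ?(psdmx_tr pA)//; have [_] := pA.
(* This scaling makes [trblk (g *: N)] exactly the deficit [D]. It uses only the fraction
   [\tr D / \tr K] of the slack [K], and that fraction is at most 1 because [m <= n]. Strictness of
   the trace hypothesis is what gives [\tr K > 0]. *)
pose g := (\tr K)^-1; have g0 : 0 <= g by rewrite invr_ge0 ltW.
pose W2 := kap^-1 *: (W' + g *: N).
have fW2 : sdp_feasible W2.
  split.
  - by apply: psdmxZ; [rewrite invr_ge0 ltW|apply: psdmxD => //; exact: psdmxZ].
  - rewrite -/(sumblk W2) /W2 sumblkZ sumblkD sumblkZ sN scalerA.
    have -> : 1%:M = kap^-1 *: (sumblk W' + K) :> 'M[R]_n.
      by rewrite /K addrC subrK scale_scalar_mx mulVf ?gt_eqF.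
    apply: loewnerZ; first by rewrite invr_ge0 ltW.
    apply: loewnerD; first exact: loewner_refl.
    rewrite /loewner_le -{1}[K]scale1r -scalerBl; apply: psdmxZ => //.
    rewrite subr_ge0 /g mulrC ler_pdivrMr// mul1r trK trD lerD2r.
    by rewrite ler_wpM2l ?ler_nat// ltW.
  - move=> j j'; have : trblk W2 = 1%:M.
      rewrite /W2 trblkZ trblkD trblkZ tN scalerA mulVf ?gt_eqF// scale1r /D.
      by rewrite addrC subrK scale_scalar_mx mulVf ?gt_eqF.
    by move=> /matrixP/(_ j j'); rewrite !mxE.
have := optW _ fW2; rewrite frobeniusZ frobeniusD frobeniusZ ler_pdivrMl//.
by apply: le_trans; rewrite lerDl mulr_ge0.
Qed.

End relaxed_optimality.

(** * Wick's formula *)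

Section gaussian_vector.
Context {R : realType} d (T : measurableType d) (P : probability T R).
Variables (k : nat) (h : T -> 'cV[R]_k) (S : 'M[R]_k).
Hypothesis pS : psdmx S.
Hypothesis mh : forall i, measurable_fun setT (fun w => h w i 0).
Hypothesis hS : centered_gaussian (pushforward P h) S.
Local Notation L1 := (L1 P).
Local Notation L2 := (L2 P).
Local Notation Ex := (expect P).

Definition lform (a : 'cV[R]_k) w : R := (a^T *m h w) 0 0.
Definition bform (a b : 'cV[R]_k) : R := (a^T *m S *m b) 0 0.

Lemma lformD a b w : lform (a + b) w = lform a w + lform b w.
Proof. by rewrite /lform linearD/= mulmxDl mxE. Qed.

Lemma lformZ c a w : lform (c *: a) w = c * lform a w.
Proof. by rewrite /lform linearZ/= -scalemxAl mxE. Qed.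

Lemma bformC a b : bform a b = bform b a.
Proof.
rewrite /bform -[in LHS](psdmx_tr pS).
have -> : (a^T *m S^T *m b) = (b^T *m S *m a)^T by rewrite !trmx_mul trmxK mulmxA.
by rewrite mxE.
Qed.

Lemma bformDl a b c : bform (a + b) c = bform a c + bform b c.
Proof. by rewrite /bform linearD/= !mulmxDl mxE. Qed.

Lemma bformZl s a c : bform (s *: a) c = s * bform a c.
Proof. by rewrite /bform linearZ/= -!scalemxAl mxE. Qed.

Lemma bformDr a b c : bform c (a + b) = bform c a + bform c b.
Proof. by rewrite /bform mulmxDr mxE. Qed.

Lemma bformZr s a c : bform c (s *: a) = s * bform c a.
Proof. by rewrite /bform -scalemxAr mxE. Qed.

Lemma measurable_lform a : measurable_fun setT (lform a).
Proof.
rewrite (_ : lform a = (fun w => \sum_j a^T 0 j * h w j 0)).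
  by apply: measurable_sum => j; exact: measurable_funM.
by apply/funext => w; rewrite /lform mxE.
Qed.

Lemma distribution_lform a B : measurable B ->
  P (lform a @^-1` B) = normal0 (bform a a) B.
Proof. exact: hS. Qed.

(** Here [c] is the moment of order [2 * q] under variance 1/2, so a form of variance [v]
    contributes the scale factor [(2 * v) ^+ q]. *)
Lemma lform_moment a (q : nat) (c : R) : (0 < q)%N ->
  (\int[@lebesgue_measure R]_x ((x ^+ (2 * q) * gauss_fun x)%R)%:E =
    (Num.sqrt pi * c)%:E)%E ->
  (\int[P]_w ((lform a w ^+ (2 * q))%R)%:E = ((2 * bform a a) ^+ q * c)%R%:E)%E.
Proof.
move=> q0 hc.
have v0 : 0 <= bform a a by have [_] := pS; exact.
(* A form of variance zero has the Dirac law at 0, and its moment vanishes because [q > 0]. *)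
have [va0|vn0] := eqVneq (bform a a) 0.
  pose X : {mfun T >-> measurableTypeR R} := HB.pack (lform a : T -> measurableTypeR R)
    (isMeasurableFun.Build _ _ T (measurableTypeR R) (lform a) (measurable_lform a)).
  rewrite va0 mulr0 expr0n eqn0Ngt q0 mul0r.
  transitivity (\int[distribution P X]_x ((x ^+ (2 * q))%R)%:E)%E.
    rewrite ge0_integral_distribution//.
    - by apply/measurable_EFinP; exact: exprn_measurable.
    - by move=> x; rewrite lee_fin exprn_even_ge0// oddM.
  transitivity (\int[\d_((0 : R)%R : measurableTypeR R)]_x ((x ^+ (2 * q))%R)%:E)%E.
    apply: eq_measure_integral => A mA _.
    by rewrite [LHS](distribution_lform a mA) va0 /normal0 eqxx.
  rewrite integral_dirac//.
    by rewrite diracT mul1e expr0n muln_eq0/= eqn0Ngt q0.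
  by apply/measurable_EFinP; exact: exprn_measurable.
(* Rescale [a] to variance 1/2, where the density is [gauss_fun] up to a factor. *)
pose s := Num.sqrt (2 * bform a a).
have s2 : s ^+ 2 = 2 * bform a a by rewrite sqr_sqrtr// mulr_ge0.
have s0 : s != 0.
  by rewrite -sqrf_eq0 s2 mulf_neq0.
pose b := s^-1 *: a.
have aE : a = s *: b by rewrite /b scalerA divff// scale1r.
have vb : bform b b = 2^-1.
  rewrite /b bformZl bformZr; apply: (mulfI (_ : s ^+ 2 != 0)).
    by rewrite sqrf_eq0.
  by rewrite [in RHS]s2; field; rewrite s0.
have hb : (\int[P]_w ((lform b w ^+ (2 * q))%R)%:E = c%:E)%E.
  apply: normal0_half_moment hc => //; first exact: measurable_lform.
  by move=> B mB; rewrite (distribution_lform b mB) vb.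
under eq_integral => w _ do rewrite {1}aE lformZ exprMn EFinM.
rewrite ge0_integralZl//=.
- by rewrite hb exprM s2 EFinM.
- apply/measurable_EFinP; apply: measurable_funX; exact: measurable_lform.
- by move=> w _; rewrite lee_fin exprn_even_ge0// oddM.
- by rewrite lee_fin exprn_even_ge0// oddM.
Qed.

Lemma lform_moment2 a : (\int[P]_w ((lform a w ^+ 2)%R)%:E = (bform a a)%:E)%E.
Proof.
rewrite (@lform_moment a 1 2^-1)//; first by congr EFin; field.
by rewrite integral_gauss2.
Qed.

Lemma lform_moment4 a :
  (\int[P]_w ((lform a w ^+ 4)%R)%:E = (3 * bform a a ^+ 2)%R%:E)%E.
Proof.
rewrite (@lform_moment a 2 (3 / 4))//; first by congr EFin; field.
by rewrite integral_gauss4; congr EFin; field.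
Qed.

Lemma L1_lformX a q (c : R) : odd q = false ->
  (\int[P]_w ((lform a w ^+ q)%R)%:E = c%:E)%E -> L1 (fun w => lform a w ^+ q).
Proof.
move=> oq hc; apply/L1P/integrableP; split.
  apply/measurable_EFinP; apply: measurable_funX; exact: measurable_lform.
under eq_integral => w _ do rewrite /= ger0_norm ?exprn_even_ge0 ?oq//.
by rewrite hc ltry.
Qed.

Lemma Ex_lform4 a : Ex (fun w => lform a w ^+ 4) = 3 * bform a a ^+ 2.
Proof. by rewrite /expect unlock lform_moment4. Qed.

Lemma Ex_lform2 a : Ex (fun w => lform a w ^+ 2) = bform a a.
Proof. by rewrite /expect unlock lform_moment2. Qed.

Lemma L1_lform4 a : L1 (fun w => lform a w ^+ 4).
Proof. exact: L1_lformX (lform_moment4 a). Qed.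

Lemma L1_lform2 a : L1 (fun w => lform a w ^+ 2).
Proof. exact: L1_lformX (lform_moment2 a). Qed.

Lemma L2_lform a : L2 (lform a).
Proof. by apply: L2P; [exact: measurable_lform|exact: L1_lform2]. Qed.

Lemma L2_lform_sqr a : L2 (fun w => lform a w ^+ 2).
Proof.
apply: L2P; first by apply: measurable_funX; exact: measurable_lform.
by under eq_fun do rewrite -exprM; exact: L1_lform4.
Qed.

Lemma lformM_polar a b w : lform a w * lform b w =
  4^-1 * lform (a + b) w ^+ 2 + - 4^-1 * lform (a + (-1) *: b) w ^+ 2.
Proof. by rewrite !lformD lformZ; field. Qed.

Lemma L2_lformM a b : L2 (fun w => lform a w * lform b w).
Proof.
under eq_fun do rewrite lformM_polar.
by apply: L2D; apply: L2Z; exact: L2_lform_sqr.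
Qed.

Lemma Ex_lformM a b : Ex (fun w => lform a w * lform b w) = bform a b.
Proof.
under eq_fun do rewrite lformM_polar.
rewrite ExD; [|exact/L1Z/L1_lform2..].
rewrite !ExZ; [|exact: L1_lform2..].
rewrite !Ex_lform2 !(bformDl, bformDr, bformZl, bformZr) (bformC b a).
by field.
Qed.

(** Polarisation by [12 x^2 y^2 = (x + y)^4 + (x - y)^4 - 2 x^4 - 2 y^4] reduces to fourth moments
    of single forms. *)
Lemma Ex_lform_sqrM a b : Ex (fun w => lform a w ^+ 2 * lform b w ^+ 2) =
  bform a a * bform b b + 2 * bform a b ^+ 2.
Proof.
have E w : lform a w ^+ 2 * lform b w ^+ 2 =
    12^-1 * lform (a + b) w ^+ 4 + (12^-1 * lform (a + (-1) *: b) w ^+ 4 +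
    (- 6^-1 * lform a w ^+ 4 + - 6^-1 * lform b w ^+ 4)).
  by rewrite !lformD lformZ; field.
have l4 c u : L1 (fun w => c * lform u w ^+ 4) by exact/L1Z/L1_lform4.
under eq_fun do rewrite E.
rewrite ExD; [|exact: l4|by apply: L1D; [exact: l4|apply: L1D; exact: l4]].
rewrite ExD; [|exact: l4|by apply: L1D; exact: l4].
rewrite ExD; [|exact: l4..].
rewrite !ExZ; [|exact: L1_lform4..].
rewrite !Ex_lform4 !(bformDl, bformDr, bformZl, bformZr) (bformC b a); by field.
Qed.

(** Each of the two products is a quarter of a difference of squares, so their product is a
    combination of the mixed moments of [Ex_lform_sqrM]. *)
Lemma Ex_wick a b c e :
  Ex (fun w => lform a w * lform b w * (lform c w * lform e w)) =
  bform a b * bform c e + bform a e * bform b c + bform a c * bform b e.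
Proof.
pose s u v w := lform u w ^+ 2 * lform v w ^+ 2.
have E w : lform a w * lform b w * (lform c w * lform e w) =
    16^-1 * s (a + b) (c + e) w + (- 16^-1 * s (a + b) (c + (-1) *: e) w +
    (- 16^-1 * s (a + (-1) *: b) (c + e) w +
     16^-1 * s (a + (-1) *: b) (c + (-1) *: e) w)).
  by rewrite /s !(lformD, lformZ); field.
have l4 u v : L1 (s u v) by apply: L2M; exact: L2_lform_sqr.
have l4' x u v : L1 (fun w => x * s u v w) by apply: L1Z.
under eq_fun do rewrite E.
rewrite ExD; [|exact: l4'|by apply: L1D; [exact: l4'|apply: L1D; exact: l4']].
rewrite ExD; [|exact: l4'|by apply: L1D; exact: l4'].
rewrite ExD; [|exact: l4'..].
rewrite !ExZ; [|exact: l4..].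
rewrite !Ex_lform_sqrM !(bformDl, bformDr, bformZl, bformZr).
rewrite ?(bformC b a) ?(bformC e c) ?(bformC c a)
  ?(bformC e a) ?(bformC c b) ?(bformC e b).
by field.
Qed.

End gaussian_vector.

Section wick_bound.
Context {R : realType}.

Lemma mulmx4E n1 n2 n3 n4 n5 (A : 'M[R]_(n1, n2)) (B : 'M[R]_(n2, n3))
    (C : 'M[R]_(n3, n4)) (D : 'M[R]_(n4, n5)) p q :
  ((A *m B) *m (C *m D)) p q =
  \sum_j \sum_i \sum_k (A p i * B i j * (C j k * D k q)).
Proof.
rewrite mxE; apply: eq_bigr => j _; rewrite !mxE mulr_suml; apply: eq_bigr => i _.
by rewrite mulr_sumr.
Qed.

(** The value of [E (G^T G)^2] when the covariance of [vec G] is the sum of the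
    [vec (g r) *m (vec (g r))^T]. The three terms pair the four factors of [G^T G G^T G] as 12-34,
    14-23 and 13-24. *)
Definition wick_gram n m (I : finType) (g : I -> 'M[R]_(n, m)) : 'M[R]_m :=
  \sum_r \sum_s ((g r)^T *m g r *m ((g s)^T *m g s) +
    (g r)^T *m g s *m ((g s)^T *m g r) + (g r)^T *m g s *m ((g r)^T *m g s)).

(** The fourth moment formula is taken as a hypothesis on entries, which lets the result apply to
    the transpose of a Gaussian matrix as well. *)
Lemma mEx_gram2 d (T : measurableType d) (P : probability T R) n m (I : finType)
    (G : T -> 'M[R]_(n, m)) (g : I -> 'M[R]_(n, m)) :
  let c i j k l := \sum_r g r i j * g r k l in
  (forall i j k l, L2 P (fun w => G w i j * G w k l)) ->
  (forall i1 j1 i2 j2 i3 j3 i4 j4,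
     expect P (fun w => G w i1 j1 * G w i2 j2 * (G w i3 j3 * G w i4 j4)) =
     c i1 j1 i2 j2 * c i3 j3 i4 j4 + c i1 j1 i4 j4 * c i2 j2 i3 j3 +
     c i1 j1 i3 j3 * c i2 j2 i4 j4) ->
  mEx P (fun w => (G w)^T *m G w *m ((G w)^T *m G w)) = wick_gram g.
Proof.
move=> c hL hE; apply/matrixP => p q.
have L j i k : L1 P (fun w => G w i p * G w i j * (G w k j * G w k q)) by exact: L2M.
rewrite mxE; transitivity (\sum_j \sum_i \sum_k
    expect P (fun w => G w i p * G w i j * (G w k j * G w k q))).
  rewrite (_ : (fun w => _) = (fun w => \sum_j \sum_i \sum_k
      (G w i p * G w i j * (G w k j * G w k q)))); last first.
    apply/funext => w; rewrite mulmx4E.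
    by do 3!(apply: eq_bigr => ? _); rewrite !mxE.
  rewrite Ex_sum => [|j]; last by do 2!(apply: L1_sum => ?).
  apply: eq_bigr => j _; rewrite Ex_sum => [|i]; last by apply: L1_sum => ?.
  by apply: eq_bigr => i _; rewrite Ex_sum.
rewrite /wick_gram summxE; under [RHS]eq_bigr => r _ do rewrite summxE.
transitivity (\sum_j \sum_i \sum_k \sum_r \sum_s
    (g r i p * g r i j * (g s k j * g s k q) +
     g r i p * g s i j * (g s k j * g r k q) +
     g r i p * g s i j * (g r k j * g s k q))).
  apply: eq_bigr => j _; apply: eq_bigr => i _; apply: eq_bigr => k _.
  rewrite hE /c !mulr_suml -!big_split/=; apply: eq_bigr => r _.
  rewrite !mulr_sumr -!big_split/=; apply: eq_bigr => s _; ring.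
(* The covariance indices [r] and [s] are carried outwards past the matrix indices, one sum at a
   time. *)
transitivity (\sum_r \sum_s \sum_j \sum_i \sum_k
    (g r i p * g r i j * (g s k j * g s k q) +
     g r i p * g s i j * (g s k j * g r k q) +
     g r i p * g s i j * (g r k j * g s k q))).
  under eq_bigr => j _ do
    (under eq_bigr => i _ do rewrite exchange_big/=; rewrite exchange_big/=).
  rewrite exchange_big/=; apply: eq_bigr => r _.
  under eq_bigr => j _ do
    (under eq_bigr => i _ do rewrite exchange_big/=; rewrite exchange_big/=).
  by rewrite exchange_big/=.
apply: eq_bigr => r _; apply: eq_bigr => s _.
rewrite [RHS]mxE [X in _ = X + _]mxE !mulmx4E -!big_split/=; apply: eq_bigr => j _.
rewrite -!big_split/=; apply: eq_bigr => i _.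
rewrite -!big_split/=; apply: eq_bigr => k _.
by rewrite !mxE.
Qed.

(** Each pairing is at most [C], the sum of the [(g r)^T *m g r]. The first is [C *m C], handled by
    [C <= 1]. The second is a sum of congruences of [C'], handled by [C' <= 1]. The third is
    dominated by the second. *)
Lemma wick_gram_le n m (I : finType) (g : I -> 'M[R]_(n, m)) :
  loewner_le (\sum_r (g r)^T *m g r) 1%:M ->
  loewner_le (\sum_r g r *m (g r)^T) 1%:M ->
  loewner_le (wick_gram g) (3%:R *: \sum_r (g r)^T *m g r).
Proof.
move=> C1 C'1; set C := \sum_r _ in C1 *; set C' := \sum_r _ in C'1.
pose T2 := \sum_r \sum_s (g r)^T *m g s *m ((g s)^T *m g r).
pose T3 := \sum_r \sum_s (g r)^T *m g s *m ((g r)^T *m g s).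
have -> : wick_gram g = C *m C + T2 + T3.
  rewrite /C mulmx_suml /T2 /T3 -!big_split/=; apply: eq_bigr => r _.
  by rewrite mulmx_sumr -!big_split/=.
have pC : psdmx C by apply: psdmx_sum => r; exact: psdmx_gram.
have T2C : loewner_le T2 C.
  rewrite /T2 /C; apply: loewner_sum => r.
  have := loewner_congr (g r) C'1; rewrite mulmx1; congr loewner_le.
  rewrite /C' mulmx_sumr mulmx_suml; apply: eq_bigr => s _.
  by rewrite !mulmxA.
have T32 : loewner_le T3 T2.
  rewrite /loewner_le.
  (* A Cauchy-Schwarz step: the Gram matrices of the antisymmetric parts of [(g s)^T *m g r] sum to
     [2 (T2 - T3)], once [r] and [s] are exchanged in half of the terms. *)
  have -> : T2 - T3 = 2^-1 *: \sum_r \sum_s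
      ((g s)^T *m g r - (g r)^T *m g s)^T *m ((g s)^T *m g r - (g r)^T *m g s).
    have -> : \sum_r \sum_s ((g s)^T *m g r - (g r)^T *m g s)^T *m
        ((g s)^T *m g r - (g r)^T *m g s) = (T2 - T3) + (T2 - T3).
      have T2E : T2 = \sum_r \sum_s (g s)^T *m g r *m ((g r)^T *m g s).
        by rewrite /T2 exchange_big.
      have T3E : T3 = \sum_r \sum_s (g s)^T *m g r *m ((g s)^T *m g r).
        by rewrite /T3 exchange_big.
      rewrite {2}T2E {2}T3E /T2 /T3 -!sumrB -big_split/=; apply: eq_bigr => r _.
      rewrite -!sumrB -big_split/=; apply: eq_bigr => s _.
      rewrite [(_ - _)^T]linearB/= !trmx_mul !trmxK mulmxBl !mulmxBr opprB.
      by [].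
    have E (D : 'M[R]_m) : D = 2%:R^-1 *: (D + D).
      by rewrite -mulr2n -[D *+ 2]scaler_nat scalerA mulVf ?pnatr_eq0// scale1r.
    exact: E.
  apply: psdmxZ; first by rewrite invr_ge0.
  by apply: psdmx_sum => r; apply: psdmx_sum => s; exact: psdmx_gram.
rewrite (_ : 3%:R *: C = C + C + C); last by rewrite scaler_nat !mulrS addr0 addrA.
apply: loewnerD; last exact: loewner_trans T32 T2C.
by apply: loewnerD => //; exact: loewner_sqr.
Qed.

End wick_bound.

(** * Scalar inequalities lifted to the polar factor of a matrix *)

Section polar_bound.
Context {R : realType}.

Lemma svd_polar_tr n m p (M : 'M[R]_(n, m)) (U : 'M[R]_(n, p)) (V : 'M[R]_(m, p)) S :
  U^T *m U = 1%:M -> M = U *m S *m V^T -> is_diag_mx S ->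
  M^T *m (U *m V^T) = V *m S *m V^T.
Proof.
move=> UU -> /diag_mxP[s ->].
rewrite !trmx_mul trmxK tr_diag_mx !mulmxA -(mulmxA _ U^T U) UU mulmx1//.
Qed.

(** All three matrices have the form [V *m D *m V^T] with [D] diagonal, so the comparison takes
    place on singular values. The inner size [p] is kept apart from [n] and [m]: for a transposed
    matrix the roles of [U] and [V] are exchanged, and the tall factor then stands in the place of
    [V]. *)
Lemma svd_polar_ge n m p (M : 'M[R]_(n, m)) (U : 'M[R]_(n, p)) (V : 'M[R]_(m, p)) S
    (al be : R) :
  U^T *m U = 1%:M -> V^T *m V = 1%:M -> M = U *m S *m V^T ->
  is_diag_mx S -> (forall i, 0 <= S i i) ->
  (forall s, 0 <= s -> al * s ^+ 2 + be * s ^+ 4 <= s) ->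
  loewner_le (al *: (M^T *m M) + be *: (M^T *m M *m (M^T *m M))) (M^T *m (U *m V^T)).
Proof.
move=> UU VV ME dS S0 hs.
rewrite (svd_polar_tr UU ME dS); move: dS S0 ME => /diag_mxP[s ->] S0 ME.
have MM : M^T *m M = V *m diag_mx (\row_i s 0 i ^+ 2) *m V^T.
  rewrite ME !trmx_mul trmxK tr_diag_mx !mulmxA -(mulmxA _ U^T U) UU mulmx1.
  rewrite -(mulmxA V (diag_mx _) (diag_mx _)) mulmx_diag; congr (V *m diag_mx _ *m V^T).
have MMMM : M^T *m M *m (M^T *m M) = V *m diag_mx (\row_i s 0 i ^+ 4) *m V^T.
  rewrite MM !mulmxA -(mulmxA _ V^T V) VV mulmx1.
  rewrite -(mulmxA V (diag_mx _) (diag_mx _)) mulmx_diag.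
  congr (V *m diag_mx _ *m V^T).
  by apply/rowP => i; rewrite !mxE -exprD.
have sc a (D : 'M[R]_p) : a *: (V *m D *m V^T) = V *m (a *: D) *m V^T.
  by rewrite -scalemxAr -scalemxAl.
rewrite /loewner_le MMMM MM !sc -mulmxDl -mulmxDr -mulmxBl -mulmxBr.
rewrite -{1}[V]trmxK; apply: psdmx_congr.
rewrite -!linearZ -linearD -linearB/=; apply: psdmx_diag => i.
by rewrite !mxE subr_ge0; apply: hs; have := S0 i; rewrite mxE eqxx mulr1n.
Qed.

End polar_bound.

(** * Variation of an optimal second moment *)

Section variation.
Context {R : realType} d (T : measurableType d) (P : probability T R).
Local Notation mEx := (mEx P).
Local Notation mL1 := (mL1 P).
Local Notation mL2 := (mL2 P).

(** The first-order term is kept in the form [K + K^T], so that positivity of the cross moment [K]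
    alone decides its sign. *)
Lemma mEx_outerD p q (X Y : T -> 'M[R]_(p, q)) a : mL2 X -> mL2 Y ->
  mEx (fun w => (X w + a *: Y w) *m (X w + a *: Y w)^T) =
  mEx (fun w => X w *m (X w)^T) +
  a *: (mEx (fun w => X w *m (Y w)^T) + (mEx (fun w => X w *m (Y w)^T))^T) +
  a ^+ 2 *: mEx (fun w => Y w *m (Y w)^T).
Proof.
move=> hX hY; have hX' := mL2_tr hX; have hY' := mL2_tr hY.
have XX := mL1M hX hX'; have XY := mL1M hX hY'.
have YX := mL1M hY hX'; have YY := mL1M hY hY'.
rewrite -mEx_tr -(mExZ _ YY) -mExD//; last first.
  by move=> i j; under eq_fun do rewrite trmx_mul trmxK; exact: YX.
rewrite -mExZ; last first.
  by apply: mL1D => // i j; under eq_fun do rewrite trmx_mul trmxK; exact: YX.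
have h1 : mL1 (fun w => a *: (X w *m (Y w)^T + (X w *m (Y w)^T)^T)).
  by apply/mL1Z/mL1D => // i j; under eq_fun do rewrite trmx_mul trmxK; exact: YX.
rewrite -mExD// -mExD; [|exact: mL1D|exact: mL1Z].
congr mEx; apply/funext => w.
rewrite linearD/= linearZ/= mulmxDl !mulmxDr -!scalemxAl -!scalemxAr.
rewrite trmx_mul trmxK scalerA scalerDr -expr2 !addrA.
by [].
Qed.

Variables n m : nat.
Implicit Types X Y : T -> 'M[R]_(n, m).

Lemma vecDZ (X Y : 'M[R]_(n, m)) a : vec (X + a *: Y) = vec X + a *: vec Y.
Proof. by rewrite /vec !linearD/= !linearZ. Qed.

Lemma mL2_vec X : mL2 X -> mL2 (fun w => vec (X w)).
Proof.
move=> hX i j; rewrite ord1; case/mxvec_indexP: i => k l.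
by under eq_fun do rewrite vecE; exact: hX.
Qed.

Definition outer X Y := mEx (fun w => vec (X w) *m (vec (Y w))^T).

Lemma mL1_outer X Y : mL2 X -> mL2 Y -> mL1 (fun w => vec (X w) *m (vec (Y w))^T).
Proof. by move=> hX hY; apply: mL1M; [|apply: mL2_tr]; exact: mL2_vec. Qed.

Lemma outerE X Y i j k l :
  outer X Y (mxvec_index j i) (mxvec_index l k) = expect P (fun w => X w i j * Y w k l).
Proof.
rewrite mxE; congr expect; apply/funext => w.
by rewrite mxE big_ord1 [(vec _)^T _ _]mxE !vecE.
Qed.

Lemma psdmx_outer X : mL2 X -> psdmx (outer X X).
Proof.
move=> hX; apply: psdmx_mEx => [|w]; first exact: mL1_outer.
by rewrite -{1}[vec _]trmxK; exact: psdmx_gram.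
Qed.

Lemma sumblk_outerE X : mL2 X -> sumblk (outer X X) = mEx (fun w => X w *m (X w)^T).
Proof.
move=> hX; apply/matrixP => k l; rewrite summxE [RHS]mxE.
rewrite (_ : (fun w => _) = (fun w => \sum_i X w k i * X w l i)); last first.
  by apply/funext => w; rewrite mxE; apply: eq_bigr => i _; rewrite mxE.
rewrite Ex_sum => [|i]; last by apply: L2M; exact: hX.
by apply: eq_bigr => i _; rewrite mxE outerE.
Qed.

Lemma trblk_outerE X : mL2 X -> trblk (outer X X) = mEx (fun w => (X w)^T *m X w).
Proof.
move=> hX; apply/matrixP => k l; rewrite [LHS]mxE [RHS]mxE.
rewrite (_ : (fun w => _) = (fun w => \sum_i X w i k * X w i l)); last first.
  by apply/funext => w; rewrite mxE; apply: eq_bigr => i _; rewrite mxE.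
rewrite Ex_sum => [|i]; last by apply: L2M; exact: hX.
by apply: eq_bigr => i _; rewrite mxE outerE.
Qed.

Lemma frobenius_tr (A N : 'M[R]_(m * n)) : A^T = A -> frobenius A N^T = frobenius A N.
Proof.
by move=> sA; rewrite /frobenius sA -mxtrace_tr trmx_mul trmxK sA mxtrace_mulC.
Qed.

Lemma frobenius_outerD (A : 'M[R]_(m * n)) X Y a : A^T = A -> mL2 X -> mL2 Y ->
  frobenius A (outer (fun w => X w + a *: Y w) (fun w => X w + a *: Y w)) =
  frobenius A (outer X X) + 2 * a * frobenius A (outer X Y) +
  a ^+ 2 * frobenius A (outer Y Y).
Proof.
move=> sA hX hY; rewrite {1}/outer; under eq_fun do rewrite vecDZ.
rewrite mEx_outerD; [|exact: mL2_vec..].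
rewrite !frobeniusD !frobeniusZ frobeniusD frobenius_tr//.
rewrite -/(outer X X) -/(outer X Y) -/(outer Y Y); ring.
Qed.

Lemma frobenius_outer_Ex (A : 'M[R]_(m * n)) X : psdmx A -> mL2 X ->
  frobenius A (outer X X) = expect P (fun w => ((vec (X w))^T *m A *m vec (X w)) 0 0).
Proof.
move=> pA hX; rewrite /frobenius (psdmx_tr pA) /outer -mEx_mull; last exact: mL1_outer.
rewrite mEx_trace; last by apply: mL1_mull; exact: mL1_outer.
congr expect; apply/funext => w.
by rewrite -(frobenius_outer _ (psdmx_tr pA)) /frobenius (psdmx_tr pA).
Qed.

(** Along [G - e D] both moments decrease to first order, as their cross terms are psd. The
    remaining violation is of order [e ^+ 2], so an objective that grew to first order would
    contradict [sdp_relaxed_bound] for small [e]. *)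
Lemma sdp_first_order (A W : 'M[R]_(m * n)) (G D : T -> 'M[R]_(n, m)) :
  (0 < m)%N -> (m <= n)%N -> psdmx A -> sdp_optimal A W ->
  mL2 G -> mL2 D -> W = outer G G ->
  psdmx (mEx (fun w => (G w)^T *m D w)) ->
  psdmx (mEx (fun w => G w *m (D w)^T)) ->
  0 <= frobenius A (outer G D).
Proof.
move=> m0 mn pA oW hG hD WE pGD pGD'.
have hG' := mL2_tr hG; have hD' := mL2_tr hD.
have hDD : mL1 (fun w => (D w)^T *m D w) by exact: mL1M.
have hDD' : mL1 (fun w => D w *m (D w)^T) by exact: mL1M.
have sDD : (mEx (fun w => (D w)^T *m D w))^T = mEx (fun w => (D w)^T *m D w).
  by apply/psdmx_tr/psdmx_mEx => // w; exact: psdmx_gram.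
have sDD' : (mEx (fun w => D w *m (D w)^T))^T = mEx (fun w => D w *m (D w)^T).
  apply/psdmx_tr/psdmx_mEx => // w; rewrite -{1}[D w]trmxK; exact: psdmx_gram.
have [b1 hb1] := loewner_scalar_bound sDD; have [b2 hb2] := loewner_scalar_bound sDD'.
pose b := `|b1| + `|b2|.
have b0 : 0 <= b by rewrite addr_ge0.
have {}hb1 : loewner_le (mEx (fun w => (D w)^T *m D w)) b%:M.
  by apply: hb1; rewrite (le_trans (ler_norm _))// lerDl.
have {}hb2 : loewner_le (mEx (fun w => D w *m (D w)^T)) b%:M.
  by apply: hb2; rewrite (le_trans (ler_norm _))// lerDr.
have [fW _] := oW; have [_ sW tW] := fW.
have {}sW : loewner_le (sumblk W) 1%:M by [].
have {}tW : loewner_le (trblk W) 1%:M.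
  rewrite (_ : trblk W = 1%:M); first exact: loewner_refl.
  by apply/matrixP => i j; rewrite mxE tW mxE.
have key (q : nat) (C K E : 'M[R]_q) e : 0 < e -> loewner_le C 1%:M -> psdmx K ->
    loewner_le E b%:M ->
    loewner_le (C + (- e) *: (K + K^T) + (- e) ^+ 2 *: E) (1 + e ^+ 2 * b)%:M.
  move=> e0 hC pK hE.
  rewrite [(1 + _)%:M](raddfD (@scalar_mx R q))/=; apply: loewnerD.
    rewrite -[X in loewner_le _ X]addr0; apply: loewnerD => //.
    rewrite /loewner_le sub0r scaleNr opprK; apply: psdmxZ; first exact: ltW.
    by apply: psdmxD => //; rewrite (psdmx_tr pK).
  by rewrite sqrrN -scale_scalar_mx; apply: loewnerZ => //; exact: sqr_ge0.
have var e : 0 < e ->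
    - 2 * e * frobenius A (outer G D) + e ^+ 2 * frobenius A (outer D D) <=
    e ^+ 2 * (b + 1) * frobenius A W.
  move=> e0; pose H w := G w + (- e) *: D w.
  have hH : mL2 H by apply: mL2D => //; exact: mL2Z.
  have sH : loewner_le (sumblk (outer H H)) (1 + e ^+ 2 * b)%:M.
    rewrite sumblk_outerE// mEx_outerD//; apply: key => //.
    by rewrite -sumblk_outerE// -WE.
  have tH : loewner_le (trblk (outer H H)) (1 + e ^+ 2 * b)%:M.
    rewrite trblk_outerE// (_ : (fun w => _) =
      (fun w => ((G w)^T + (- e) *: (D w)^T) *m
        ((G w)^T + (- e) *: (D w)^T)^T)); last first.
      by apply/funext => w; rewrite /H !linearD/= !linearZ/= !trmxK.
    rewrite mEx_outerD//; under [X in mEx X + _ + _]eq_fun do rewrite trmxK.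
    under [X in _ + _ *: (mEx X + _) + _]eq_fun do rewrite trmxK.
    under [X in _ + _ *: (_ + (mEx X)^T) + _]eq_fun do rewrite trmxK.
    under [X in _ + _ *: mEx X]eq_fun do rewrite trmxK.
    by apply: key => //; rewrite -trblk_outerE// -WE.
  (* The level [b + 1] instead of [b] leaves room for the strict trace inequality demanded by
     [sdp_relaxed_bound]. *)
  have kap_le : 1 + e ^+ 2 * b <= 1 + e ^+ 2 * (b + 1).
    by rewrite lerD2l ler_wpM2l ?sqr_ge0// lerDl.
  have up q (X : 'M[R]_q) : loewner_le X (1 + e ^+ 2 * b)%:M ->
      loewner_le X (1 + e ^+ 2 * (b + 1))%:M.
    move/loewner_trans; apply; rewrite /loewner_le -(raddfB (@scalar_mx R q)).
    by apply: psdmx_scalar; rewrite subr_ge0.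
  have := @sdp_relaxed_bound R n m A W (outer H H) (1 + e ^+ 2 * (b + 1)) mn pA oW.
  have -> : frobenius A (outer H H) = _ := frobenius_outerD (- e) (psdmx_tr pA) hG hD.
  rewrite -WE => /(_ _ (psdmx_outer hH) (up _ _ sH) (up _ _ tH)) h.
  suff : frobenius A W + 2 * - e * frobenius A (outer G D) +
     (- e) ^+ 2 * frobenius A (outer D D) <= (1 + e ^+ 2 * (b + 1)) * frobenius A W by lra.
  apply: h; first by rewrite ltr_pwDl// mulr_ge0 ?sqr_ge0// addr_ge0.
  rewrite trace_sumblk; apply: le_lt_trans (loewner_trace tH) _.
  rewrite mxtrace_scalar -[_ *+ m]mulr_natr.
  apply: (@lt_le_trans _ _ ((1 + e ^+ 2 * (b + 1)) * m%:R)).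
    by rewrite ltr_pM2r ?ltr0n// ltrD2l ltr_pM2l ?exprn_gt0// ltrDl.
  by rewrite ler_wpM2l ?ler_nat// (le_trans _ kap_le)// addr_ge0// mulr_ge0// sqr_ge0.
rewrite leNgt; apply/negP => be0.
set be := frobenius A (outer G D) in be0 var.
set de := (b + 1) * frobenius A W - frobenius A (outer D D).
have {}var e : 0 < e -> - 2 * be <= e * de.
  by move=> e0; rewrite -(ler_pM2l e0) /de; have := var _ e0; lra.
have d0 : 0 < `|de| + 1 by rewrite ltr_wpDl.
have e0 : 0 < - be / (`|de| + 1) by rewrite divr_gt0// oppr_gt0.
have := var _ e0; rewrite mulrAC ler_pdivlMr// => h.
have := ler_norm de; have := normr_ge0 de; nra.
Qed.

End variation.

Lemma measurable_mx_coord d (T : measurableType d) m n (i : 'I_m) (j : 'I_n) :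
  measurable_fun setT (fun M : 'M[T]_(m, n) => M i j).
Proof.
move=> _ B mB; rewrite setTI; apply: sub_sigma_algebra.
by exists i, j, B.
Qed.

Lemma L2_bounded (R : realType) d (T : measurableType d) (P : probability T R)
    (X : T -> R) c :
  measurable_fun setT X -> (forall w, X w ^+ 2 <= c) -> L2 P X.
Proof.
move=> mX Xc; apply: L2P => //; apply/L1P.
apply: (@le_integrable _ _ _ P setT measurableT _ (EFin \o cst c)).
- by apply/measurable_EFinP; exact: measurable_funX.
- by move=> w _ /=; rewrite lee_fin ger0_norm ?sqr_ge0// (le_trans (Xc w))// ler_norm.
- by apply/L1P; exact: L1_cst.
Qed.

(** * Moments of the entries of a Gaussian matrix *)

Section gaussian_matrix.
Context {R : realType} d (T : measurableType d) (P : probability T R).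
Variables (n m : nat) (W : 'M[R]_(m * n)) (G : T -> 'M[R]_(n, m)).
Hypothesis pW : psdmx W.
Hypothesis mG : forall i j, measurable_fun setT (fun w => G w i j).
Hypothesis hG : centered_gaussian (pushforward P (fun w => vec (G w))) W.

Definition entry_form (i : 'I_n) (j : 'I_m) : 'cV[R]_(m * n) :=
  delta_mx (mxvec_index j i) 0.

Lemma lform_entry i j w : lform (fun w => vec (G w)) (entry_form i j) w = G w i j.
Proof. by rewrite /lform /entry_form trmx_delta -rowE mxE vecE. Qed.

Lemma bform_entry i j k l :
  bform W (entry_form i j) (entry_form k l) = W (mxvec_index j i) (mxvec_index l k).
Proof. by rewrite /bform /entry_form trmx_delta -rowE -colE !mxE. Qed.

Lemma measurable_vec i : measurable_fun setT (fun w => vec (G w) i 0).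
Proof.
case/mxvec_indexP: i => j k.
by under eq_fun do rewrite vecE; exact: mG.
Qed.

Lemma mL2_gaussian : mL2 P G.
Proof.
move=> i j; under eq_fun do rewrite -lform_entry.
exact (L2_lform pW measurable_vec hG _).
Qed.

Lemma L2_gaussianM i j k l : L2 P (fun w => G w i j * G w k l).
Proof.
under eq_fun do rewrite -!lform_entry.
exact (L2_lformM pW measurable_vec hG _ _).
Qed.

Lemma gaussian_outer : W = outer P G G.
Proof.
apply/matrixP => a b; case/mxvec_indexP: a => j i; case/mxvec_indexP: b => l k.
rewrite outerE -bform_entry -(Ex_lformM pW measurable_vec hG).
by congr expect; apply/funext => w; rewrite !lform_entry.
Qed.

Lemma gaussian_wick i1 j1 i2 j2 i3 j3 i4 j4 :
  let c i j k l := W (mxvec_index j i) (mxvec_index l k) in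
  expect P (fun w => G w i1 j1 * G w i2 j2 * (G w i3 j3 * G w i4 j4)) =
     c i1 j1 i2 j2 * c i3 j3 i4 j4 + c i1 j1 i4 j4 * c i2 j2 i3 j3 +
     c i1 j1 i3 j3 * c i2 j2 i4 j4.
Proof.
rewrite /= -!bform_entry -(Ex_wick pW measurable_vec hG).
by congr expect; apply/funext => w; rewrite !lform_entry.
Qed.

End gaussian_matrix.

Section polar_gaussian.
Context {R : realType}.

(** The difference of the two sides is [sqrt 3 / 18 * s * (s - sqrt 3)^2 * (s + 2 * sqrt 3)]:
    equality holds at 0, and there is tangency at [sqrt 3]. *)
Lemma polar_scalar_bound (s : R) : 0 <= s ->
  Num.sqrt 3 / 2 * s ^+ 2 + - (Num.sqrt 3 / 18) * s ^+ 4 <= s.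
Proof.
move=> s0; set t := Num.sqrt 3.
have t0 : 0 <= t by exact: sqrtr_ge0.
have t2 : t ^+ 2 = 3 by rewrite sqr_sqrtr.
have : 0 <= t / 18 * (s * (s - t) ^+ 2 * (s + 2 * t)).
  apply: mulr_ge0; first by rewrite divr_ge0.
  apply: mulr_ge0; last by rewrite addr_ge0// mulr_ge0.
  by apply: mulr_ge0 => //; exact: sqr_ge0.
have -> : t / 18 * (s * (s - t) ^+ 2 * (s + 2 * t)) =
  t / 18 * s ^+ 4 - t * t ^+ 2 / 6 * s ^+ 2 + (t ^+ 2) ^+ 2 / 9 * s by field.
rewrite t2; lra.
Qed.

Lemma polar_expectation_ge d (T : measurableType d) (P : probability T R) n m p
    (I : finType) (G : T -> 'M[R]_(n, m)) (U : T -> 'M[R]_(n, p))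
    (V : T -> 'M[R]_(m, p))
    (S : T -> 'M[R]_p) (g : I -> 'M[R]_(n, m)) :
  (forall w, [/\ (U w)^T *m U w = 1%:M, (V w)^T *m V w = 1%:M,
     G w = U w *m S w *m (V w)^T,
     is_diag_mx (S w) & forall i, 0 <= S w i i]) ->
  mL2 P G -> mL2 P (fun w => U w *m (V w)^T) ->
  mL2 P (fun w => (G w)^T *m G w) ->
  mEx P (fun w => (G w)^T *m G w) = \sum_r (g r)^T *m g r ->
  mEx P (fun w => (G w)^T *m G w *m ((G w)^T *m G w)) = wick_gram g ->
  loewner_le (\sum_r (g r)^T *m g r) 1%:M ->
  loewner_le (\sum_r g r *m (g r)^T) 1%:M ->
  loewner_le ((Num.sqrt 3 / 3) *: mEx P (fun w => (G w)^T *m G w))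
    (mEx P (fun w => (G w)^T *m (U w *m (V w)^T))).
Proof.
move=> hsvd hG hQ hGG E2 E4 C1 C'1.
have hG' := mL2_tr hG.
have GG1 : mL1 P (fun w => (G w)^T *m G w) by exact: mL1M.
have GQ1 : mL1 P (fun w => (G w)^T *m (U w *m (V w)^T)) by exact: mL1M.
have GGGG1 := mL1M hGG hGG.
pose al : R := Num.sqrt 3 / 2; pose be : R := Num.sqrt 3 / 18.
apply: (@loewner_trans _ _ (mEx P (fun w => al *: ((G w)^T *m G w) +
    - be *: ((G w)^T *m G w *m ((G w)^T *m G w))))); last first.
  apply: loewner_mEx => // [|w]; first by apply: mL1D; exact: mL1Z.
  have [UU VV GE dS S0] := hsvd w.
  exact: svd_polar_ge UU VV GE dS S0 polar_scalar_bound.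
rewrite mExD; [|exact: mL1Z..]; rewrite !mExZ// E2 E4; set C := \sum_r _ in C1 *.
(* The constant [c] arises as [al - 3 * be]. *)
have -> : (Num.sqrt 3 / 3) *: C = al *: C - be *: (3%:R *: C).
  by rewrite scalerA -scalerBl; congr (_ *: _); rewrite /al /be; field.
apply: loewnerD; first exact: loewner_refl.
rewrite scaleNr /loewner_le opprK addrC -scalerBr; apply: psdmxZ.
  by rewrite /be divr_ge0// sqrtr_ge0.
exact: wick_gram_le.
Qed.

End polar_gaussian.

Theorem theorem3 (R : realType) (n m : nat) (hm : (1 <= m)%N) (hmn : (m <= n)%N)
  (A : 'M[R]_(m * n)) (hA : psdmx A)
  (W : 'M[R]_(m * n)) (hW : sdp_optimal A W)
  (d : measure_display) (T : measurableType d) (P : probability T R)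
  (G : {RV P >-> 'M[R]_(n, m)})
  (hG : centered_gaussian (pushforward P (fun w => vec (G w))) W)
  (U : {mfun 'M[R]_(n, m) >-> 'M[R]_(n, m)})
  (S V : {mfun 'M[R]_(n, m) >-> 'M[R]_m})
  (hsvd : forall M : 'M[R]_(n, m), is_svd M (U M) (S M) (V M))
  (Q : T -> 'M[R]_(n, m)) (hQ : forall w, Q w = U (G w) *m (V (G w))^T) :
  ((3%:R^-1 * frobenius A W)%:E <=
     'E_P[fun w => (((vec (Q w))^T *m A *m vec (Q w)) 0 0)%R])%E.
Proof.
have pW : psdmx W by have [[]] := hW.
have mGij i j : measurable_fun setT (fun w => G w i j).
  by apply: (measurableT_comp (measurable_mx_coord i j)).
have hG2 := mL2_gaussian pW mGij hG.
have GGij := L2_gaussianM pW mGij hG.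
have WE := gaussian_outer pW mGij hG.
have wick := gaussian_wick pW mGij hG.
have [B BE] := psdmx_cholesky pW.
(* The rows of the Cholesky factor, reshaped so that [vec (g r)] is the transpose of row [r] of [B].
   They split the covariance into rank one pieces, as [wick_gram] expects. *)
pose g r : 'M[R]_(n, m) := (vec_mx (row r B))^T.
have Wg i j k l : W (mxvec_index j i) (mxvec_index l k) = \sum_r g r i j * g r k l.
  rewrite BE mxE; apply: eq_bigr => r _.
  by rewrite /g !mxE.
have Wo : W = \sum_r vec (g r) *m (vec (g r))^T.
  apply/matrixP => a b; case/mxvec_indexP: a => j i; case/mxvec_indexP: b => l k.
  rewrite Wg summxE; apply: eq_bigr => r _.
  by rewrite [RHS]mxE big_ord1 [(vec _)^T _ _]mxE !vecE.
have tW : trblk W = \sum_r (g r)^T *m g r.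
  by rewrite Wo trblk_sum; apply: eq_bigr => r _; rewrite trblk_outer.
have sW : sumblk W = \sum_r g r *m (g r)^T.
  by rewrite Wo sumblk_sum; apply: eq_bigr => r _; rewrite sumblk_outer.
have t1 : \sum_r (g r)^T *m g r = 1%:M.
  have [[_ _ trW] _] := hW.
  by rewrite -tW; apply/matrixP => i j; rewrite mxE trW mxE.
have s1 : loewner_le (\sum_r g r *m (g r)^T) 1%:M.
  by rewrite -sW; have [[_ + _] _] := hW.
have EGG : mEx P (fun w => (G w)^T *m G w) = \sum_r (g r)^T *m g r.
  by rewrite -trblk_outerE// -WE.
have EGG' : mEx P (fun w => G w *m (G w)^T) = \sum_r g r *m (g r)^T.
  by rewrite -sumblk_outerE// -WE.
have QQ w : (Q w)^T *m Q w = 1%:M.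
  have [UU _ VV _] := hsvd (G w).
  by rewrite hQ trmx_mul trmxK mulmxA -(mulmxA _ _ (U _)) UU mulmx1 (mulmx1C VV).
(* Columns of [Q w] are unit vectors, so its entries are bounded and hence square integrable. *)
have Q1 w i j : Q w i j ^+ 2 <= 1.
  have : ((Q w)^T *m Q w) j j = 1 by rewrite QQ mxE eqxx.
  rewrite mxE => <-; rewrite (bigD1 i)//= mxE -expr2 lerDl sumr_ge0// => k _.
  by rewrite mxE -expr2 sqr_ge0.
have mU i j : measurable_fun setT (fun w => U (G w) i j).
  by apply: (measurableT_comp (measurable_mx_coord i j)); exact: measurableT_comp.
have mV i j : measurable_fun setT (fun w => V (G w) i j).
  by apply: (measurableT_comp (measurable_mx_coord i j)); exact: measurableT_comp.
have hQ2 : mL2 P Q.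
  move=> i j; apply: (@L2_bounded _ _ _ _ _ 1) => [|w]; last exact: Q1.
  under eq_fun do rewrite hQ mxE; apply: measurable_sum => k.
  apply: measurable_funM; first exact: mU.
  by under eq_fun do rewrite mxE; exact: mV.
have QE : Q = (fun w => U (G w) *m (V (G w))^T) by apply/funext.
have K1 : loewner_le ((Num.sqrt 3 / 3) *: mEx P (fun w => (G w)^T *m G w))
    (mEx P (fun w => (G w)^T *m Q w)).
  rewrite QE; apply: (polar_expectation_ge (S := S \o G) (g := g)) => //=.
  - by move=> w; have [UU [dS S0] VV GE] := hsvd (G w).
  - by rewrite -QE.
  - move=> i j; under eq_fun do rewrite mxE.
    by apply: L2_sum => k; under eq_fun do rewrite mxE; exact: GGij.
  - apply: mEx_gram2 => [|i1 j1 i2 j2 i3 j3 i4 j4]; first exact: GGij.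
    by rewrite wick !Wg.
  - by rewrite t1; exact: loewner_refl.
(* The same bound for [G^T], whose singular value decomposition exchanges [U] and [V] and whose
   polar factor is therefore [Q^T]. *)
have K2 : loewner_le ((Num.sqrt 3 / 3) *: mEx P (fun w => G w *m (G w)^T))
    (mEx P (fun w => G w *m (Q w)^T)).
  have trE w : G w = ((G w)^T)^T by rewrite trmxK.
  have := @polar_expectation_ge R d T P m n m 'I_(m * n) (fun w => (G w)^T)
    (V \o G) (U \o G) (S \o G) (fun r => (g r)^T).
  have -> : (fun w => ((G w)^T)^T *m (G w)^T) = (fun w => G w *m (G w)^T).
    by apply/funext => w; rewrite trmxK.
  have -> : (fun w => ((G w)^T)^T *m ((V \o G) w *m ((U \o G) w)^T)) =
      (fun w => G w *m (Q w)^T).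
    by apply/funext => w; rewrite trmxK hQ trmx_mul trmxK.
  have -> : (fun w => (V \o G) w *m ((U \o G) w)^T) = (fun w => (Q w)^T).
    by apply/funext => w; rewrite hQ trmx_mul trmxK.
  have -> : \sum_r (g r)^T^T *m (g r)^T = \sum_r g r *m (g r)^T.
    by apply: eq_bigr => r _; rewrite trmxK.
  have -> : \sum_r (g r)^T *m (g r)^T^T = \sum_r (g r)^T *m g r.
    by apply: eq_bigr => r _; rewrite trmxK.
  apply => //.
  - move=> w; have [UU [dS S0] VV GE] := hsvd (G w); split=> //=.
    rewrite [in LHS]GE !trmx_mul trmxK mulmxA.
    by have /diag_mxP[s ->] := dS; rewrite tr_diag_mx.
  - exact: mL2_tr.
  - exact: mL2_tr.
  - move=> i j; under eq_fun do rewrite mxE.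
    by apply: L2_sum => k; under eq_fun do rewrite mxE; exact: GGij.
  - rewrite -(mEx_gram2 (P := P) (G := fun w => (G w)^T))
      => [|i j k l|i1 j1 i2 j2 i3 j3 i4 j4].
    + by congr mEx; apply/funext => w; rewrite trmxK.
    + by under eq_fun do rewrite !mxE; exact: GGij.
    + under eq_fun do rewrite !mxE.
      rewrite wick !Wg.
      by congr (_ * _ + _ * _ + _ * _); apply: eq_bigr => r _; rewrite !mxE.
  - by rewrite t1; exact: loewner_refl.
pose c : R := Num.sqrt 3 / 3.
have c2 : c ^+ 2 = 3^-1 by rewrite /c exprMn sqr_sqrtr//; field.
pose D w := Q w + (- c) *: G w.
have hD : mL2 P D by apply: mL2D => //; exact: mL2Z.
have hG2' := mL2_tr hG2; have hQ2' := mL2_tr hQ2.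
have D1 : psdmx (mEx P (fun w => (G w)^T *m D w)).
  rewrite (_ : (fun w => _) = (fun w => (G w)^T *m Q w + (- c) *: ((G w)^T *m G w))).
    by rewrite mExD; [|exact: mL1M|apply: mL1Z; exact: mL1M];
      rewrite mExZ; [rewrite scaleNr|exact: mL1M].
  by apply/funext => w; rewrite mulmxDr -scalemxAr.
have D2 : psdmx (mEx P (fun w => G w *m (D w)^T)).
  rewrite (_ : (fun w => _) = (fun w => G w *m (Q w)^T + (- c) *: (G w *m (G w)^T))).
    by rewrite mExD; [|exact: mL1M|apply: mL1Z; exact: mL1M];
      rewrite mExZ; [rewrite scaleNr|exact: mL1M].
  by apply/funext => w; rewrite linearD/= linearZ/= mulmxDr -scalemxAr.
have sA := psdmx_tr hA.
have be0 := sdp_first_order hm hmn hA hW hG2 hD WE D1 D2.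
(* Symmetry of [A] allows [outer P G D] to be transposed, which puts the sum [D] in the left slot,
   where it can be expanded. *)
have GDE : frobenius A (outer P G D) = frobenius A (outer P Q G) - c * frobenius A W.
  rewrite -(frobenius_tr _ sA) WE -mulNr -frobeniusZ -frobeniusD; congr frobenius.
  rewrite /outer -mEx_tr -mExZ; last exact: mL1_outer.
  rewrite -mExD; [|exact: mL1_outer|apply: mL1Z; exact: mL1_outer].
  congr mEx; apply/funext => w.
  by rewrite trmx_mul trmxK /D vecDZ mulmxDl -scalemxAl.
have final : 3%:R^-1 * frobenius A W <= frobenius A (outer P Q Q).
  have := frobenius_outer_Ex hA hD; rewrite frobenius_outerD// -WE.
  have := @Ex_ge0 _ _ _ P (fun w => ((vec (D w))^T *m A *m vec (D w)) 0 0).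
  move=> /(_ (fun w => hA.2 _)); set e := expect _ _ => e0 eE; move: e0.
  have c0 : 0 <= c by rewrite /c divr_ge0// sqrtr_ge0.
  (* Multiplying [be0] by [c] leaves only [c ^+ 2 = 1/3] and the product of [c] with the cross term,
     so the conclusion becomes linear. *)
  rewrite -eE sqrrN c2; move: be0; rewrite GDE => /(mulr_ge0 c0).
  by rewrite mulrBr mulrA -expr2 c2; lra.
rewrite Ex_fin; first by rewrite lee_fin -(frobenius_outer_Ex hA hQ2).
have : mL1 P (fun w => (vec (Q w))^T *m A *m vec (Q w)).
  apply: mL1M; last exact: mL2_vec.
  move=> i j; under eq_fun do rewrite mxE.
  apply: L2_sum => k; under eq_fun do rewrite mulrC; apply: L2Z.
  by have := mL2_tr (mL2_vec hQ2); apply.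
exact.
Qed.
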